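(* For every rule $\mathcal{R}$ of order $k$, every graphon $W\in\mathcal{W}_0$ and every $t,u\in I_W$, $$\|\Phi^tW-\Phi^uW\|_\infty\le (k)_2\,|t-u|,$$ and for every $\delta>0$, $$\left\|\frac{\Phi^\delta W-W}{\delta}-\mathfrak{V}_{\mathcal{R}}W\right\|_\infty\le C_k\,(k)_2\,\delta,$$ where $(k)_2=k(k-1)$ and $C_k=(k)_2^2\,2^{\binom{k}{2}-1}$.
   Context: $(\Omega,\pi)$ is a fixed atomless probability space whose sigma-algebra is separable (there is a countable family $\mathcal{C}$ of measurable sets such that for every measurable $S$ and $\delta>0$ some $T\in\mathcal{C}$ has $\pi(S\ominus T)<\delta$). $\mathcal{W}$ is the Banach space of kernels: bounded measurable functions $W:\Omega^2\to\mathbb{R}$ with $W(x,y)=W(y,x)$ a.e., identified when equal a.e., with the $L^\infty$-norm $\|\cdot\|_\infty$. $\mathcal{W}_0\subset\mathcal{W}$ is the set of graphons: kernels with values in $[0,1]$ a.e. $\mathcal{H}_k$ is the set of all (simple, labelled) graphs on vertex set $[k]$. A rule of order $k$ is a matrix $\mathcal{R}\in[0,1]^{\mathcal{H}_k\times\mathcal{H}_k}$ with $\sum_{J}\mathcal{R}_{H,J}=1$ for every $H\in\mathcal{H}_k$. For $F\in\mathcal{H}_k$, distinct $a,b\in[k]$ and $W\in\mathcal{W}$ define $$(T_F^{a,b}W)(x,y)=\int\prod_{ij\in E(F)}W(x_i,x_j)\prod_{ij\notin E(F)}(1-W(x_i,x_j))\prod_{i\in[k]\setminus\{a,b\}}\pi(\mathrm{d}x_i),\quad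 x_a=x,\ x_b=y,$$ where $ij$ ranges over unordered pairs of distinct elements of $[k]$. The velocity operator is $$\mathfrak{V}_{\mathcal{R}}W=\sum_{F,H\in\mathcal{H}_k}\mathcal{R}_{F,H}\sum_{1\le a\ne b\le k}T_F^{a,b}W\cdot\left(\mathbb{I}_{\{ab\in E(H)\setminus E(F)\}}-\mathbb{I}_{\{ab\in E(F)\setminus E(H)\}}\right),$$ the inner sum being over ordered pairs. For $W\in\mathcal{W}$, $\Phi^{\cdot}W:\mathcal{D}_W\to\mathcal{W}$ is the (unique) maximal solution, on an open interval $\mathcal{D}_W\ni0$, of $\frac{\mathrm{d}}{\mathrm{d}t}\Phi^tW=\mathfrak{V}_{\mathcal{R}}\Phi^tW$, $\Phi^0W=W$ (derivative with respect to $\|\cdot\|_\infty$). For a graphon $W$, $I_W:=\{t\in\mathcal{D}_W:\Phi^tW\in\mathcal{W}_0\}$, which is a closed interval containing $[0,\infty)$. *)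

(* Defs.v *)
From mathcomp Require Export all_boot all_order all_algebra.
From mathcomp Require Export all_classical all_reals all_analysis.

Set Implicit Arguments.
Unset Strict Implicit.
Unset Printing Implicit Defensive.

Import Order.TTheory GRing.Theory Num.Theory.
Import numFieldNormedType.Exports.

Local Open Scope classical_set_scope.
Local Open Scope ring_scope.

Definition atomless d (T : measurableType d) (R : realType)
    (P : {measure set T -> \bar R}) : Prop :=
  forall A : set T, measurable A -> (0 < P A)%E ->
    exists B : set T, [/\ measurable B, B `<=` A, (0 < P B)%E & (P B < P A)%E].

Definition separable_measure d (T : measurableType d) (R : realType)
    (P : {measure set T -> \bar R}) : Prop :=
  exists C : set (set T), [/\ countable C, C `<=` measurable &
    forall (S : set T) (e : R), measurable S -> 0 < e ->
      exists2 B : set T, C B & (P (S `+` B) < e%:E)%E].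

(* A simple labelled graph on 'I_k is its edge set, a set of 2-element subsets
   of 'I_k. *)
Definition graph (k : nat) : Type :=
  {E : {set {set 'I_k}} | [forall e in E, #|e| == 2%N]}.

Definition adj (k : nat) (F : graph k) (i j : 'I_k) : bool :=
  [set i; j]%SET \in val F.

Definition is_rule (R : realType) (k : nat) (r : graph k -> graph k -> R) : Prop :=
  (forall H J, 0 <= r H J <= 1) /\ (forall H, \sum_(J : graph k) r H J = 1).

Section kernels.
Context d (T : measurableType d) (R : realType) (P : probability T R).

(* Elements of the space of kernels are given by bounded representatives;
   equality in that space is equality (P \x P)-almost everywhere. *)
Definition is_kernel (W : T * T -> R) : Prop :=
  [/\ measurable_fun setT W,
      exists M : R, forall z, `|W z| <= M &
      {ae (P \x P)%E, forall z, W z = W (z.2, z.1)}].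

Definition is_graphon (W : T * T -> R) : Prop :=
  is_kernel W /\ {ae (P \x P)%E, forall z, 0 <= W z <= 1}.

Definition Linfty_norm (f : T * T -> R) : \bar R :=
  ('N[P \x P]_+oo[EFin \o f])%E.

(* Integral of f with respect to the product of the P(dx_i), i in s, the other
   coordinates of x being kept fixed. It is written as an iterated integral, as
   the library has no product measure on T^n; for the bounded measurable f
   below the order of integration is irrelevant by Fubini's theorem. *)
Fixpoint multi_integral (k : nat) (s : seq 'I_k) (f : ('I_k -> T) -> R)
    (x : 'I_k -> T) : R :=
  if s is i :: s' then
    \int[P]_z multi_integral s' f [eta x with i |-> z]
  else f x.

Definition induced_density (k : nat) (F : graph k) (W : T * T -> R)
    (x : 'I_k -> T) : R :=
  \prod_(i < k) \prod_(j < k | (i < j)%N)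
    (if adj F i j then W (x i, x j) else 1 - W (x i, x j)).

(* Every coordinate other than a and b of the starting point is integrated
   out, so its initial value is irrelevant. *)
Definition rooted_density (k : nat) (F : graph k) (a b : 'I_k)
    (W : T * T -> R) (z : T * T) : R :=
  multi_integral (enum (~: [set a; b])%SET) (induced_density F W)
    [eta (fun=> z.1) with b |-> z.2].

Definition velocity (k : nat) (r : graph k -> graph k -> R) (W : T * T -> R)
    (z : T * T) : R :=
  \sum_(F : graph k) \sum_(H : graph k) r F H *
    \sum_(a < k) \sum_(b < k | a != b)
      rooted_density F a b W z *
      ((adj H a b && ~~ adj F a b)%:R - (adj F a b && ~~ adj H a b)%:R).

(* Only the values of Phi on D are meaningful. *)
Definition is_solution (k : nat) (r : graph k -> graph k -> R)
    (W : T * T -> R) (D : set R) (Phi : R -> T * T -> R) : Prop :=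
  [/\ [/\ open D, is_interval D & D 0],
      forall t, D t -> is_kernel (Phi t),
      {ae (P \x P)%E, forall z, Phi 0 z = W z} &
      forall t, D t ->
        Linfty_norm (fun z => (Phi (t + h) z - Phi t z) / h
                              - velocity r (Phi t) z)
          @[h --> 0^'] --> 0%E].

Definition is_maximal_solution (k : nat) (r : graph k -> graph k -> R)
    (W : T * T -> R) (D : set R) (Phi : R -> T * T -> R) : Prop :=
  is_solution r W D Phi /\
  forall (D' : set R) (Psi : R -> T * T -> R),
    is_solution r W D' Psi -> D `<=` D' ->
    (forall t, D t -> {ae (P \x P)%E, forall z, Psi t z = Phi t z}) ->
    D' = D.

Definition graphon_times (D : set R) (Phi : R -> T * T -> R) : set R :=
  [set t | D t /\ is_graphon (Phi t)].

End kernels.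

(* Main.v *)
Require Import Defs.
From mathcomp Require Import ess_sup_inf measurable_realfun.
From mathcomp Require Import ring lra zify.

Set Implicit Arguments.
Unset Strict Implicit.
Unset Printing Implicit Defensive.

Import Order.TTheory GRing.Theory Num.Theory.
Import numFieldNormedType.Exports.
Local Open Scope classical_set_scope.
Local Open Scope ring_scope.

(** For fixed [a != b] the functions [T_F^{a,b} W] with [ab] in [E(F)] add up to [W],
    and those of all [F] add up to [1]; hence
    [- (k)_2 W <= velocity W <= (k)_2 (1 - W)] for a graphon [W], and an Euler step
    of length [h <= 1 / (k)_2] maps graphons to graphons. Since [velocity] is
    [C_k]-Lipschitz on graphons, the Euler schemes with dyadic steps converge
    uniformly to a flow [u] in the set of graphons, defined for all [t >= 0], with
    [|u (t + h) - u t - h velocity (u t)| <= C_k (k)_2 h^2]. All this holds pointwise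
    everywhere once the graphon is represented by a function that is symmetric and
    [0, 1]-valued everywhere. A Gronwall argument in the essential sup norm
    identifies [Phi] with this flow from any time at which [Phi] is a graphon
    onwards; gluing [Phi] on negative times to the flow and using maximality gives
    that [Phi] exists for all positive times. Both inequalities are then the
    increment and Taylor bounds of the flow. *)

(** * Euler schemes and a Gronwall lemma *)

(** The intervals with centre [x n] and radius [2 * A * (c / 2 ^+ n)] are nested, because the radius
    drops by exactly [A * (c / 2 ^+ n)] at each step. The supremum of their left ends lies in all of
    them. *)
Lemma geometric_cauchy_lim (R : realType) (x : nat -> R) (A c : R) :
  0 <= A -> 0 <= c ->
  (forall n, `|x n.+1 - x n| <= A * (c / 2 ^+ n)) ->
  exists l, forall n, `|x n - l| <= 2 * A * (c / 2 ^+ n).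
Proof.
move=> A0 c0 hx.
pose e n : R := 2 * A * (c / 2 ^+ n).
have e0 n : 0 <= e n by rewrite /e !mulr_ge0// invr_ge0 exprn_ge0.
have eS n : e n = e n.+1 + A * (c / 2 ^+ n).
  rewrite /e exprS invfM; field; exact/expf_neq0.
have lo : {homo (fun n => x n - e n) : m n / (m <= n)%N >-> m <= n}.
  apply: homo_leq => [y|y z w|n]; [exact: lexx|exact: le_trans|].
  by have := hx n; rewrite ler_norml (eS n) => /andP[]; lra.
have hi : {homo (fun n => x n + e n) : m n / (m <= n)%N >-> n <= m}.
  apply: homo_leq => [y|y z w|n]; [exact: lexx|by move=> /[swap]; exact: le_trans|].
  by have := hx n; rewrite ler_norml (eS n) => /andP[]; lra.
have lohi m n : x m - e m <= x n + e n.
  have := lo _ _ (leq_maxl m n); have := hi _ _ (leq_maxr m n).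
  by have := e0 (maxn m n); lra.
pose S := range (fun n => x n - e n).
have S0 : S !=set0 by exists (x 0%N - e 0%N), 0%N.
have ubS n : ubound S (x n + e n) by move=> _ [m _ <-]; exact: lohi.
exists (sup S) => n; rewrite -/(e n).
have h1 : sup S <= x n + e n by exact: ge_sup.
have h2 : x n - e n <= sup S.
  by apply: ub_le_sup; [exists (x 0%N + e 0%N); exact: ubS|exists n].
by rewrite ler_norml; lra.
Qed.

Section euler_scheme.
Context (R : realType) (Z : Type) (G : (Z -> R) -> Prop)
  (V : (Z -> R) -> Z -> R) (K L : R).

Definition euler_step (h : R) (W : Z -> R) : Z -> R := fun z => W z + h * V W z.

Context (K0 : 0 <= K) (L0 : 0 <= L)
 (Gstep : forall W (h : R), G W -> 0 <= h -> h * K <= 1 -> G (euler_step h W))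
 (Vbound : forall W, G W -> forall z, `|V W z| <= K)
 (Vlip : forall U W (e : R), G U -> G W -> (forall z, `|U z - W z| <= e) ->
    forall z, `|V U z - V W z| <= L * e).

Lemma euler_iter_mem (h : R) W m : G W -> 0 <= h -> h * K <= 1 ->
  G (iter m (euler_step h) W).
Proof. by move=> GW h0 hK; elim: m => //= m IH; exact: Gstep. Qed.

Lemma euler_iter_dist (h : R) W m : G W -> 0 <= h -> h * K <= 1 ->
  forall z, `|iter m (euler_step h) W z - W z| <= K * (h * m%:R).
Proof.
move=> GW h0 hK z; elim: m => [|m IH] /=; first by rewrite subrr normr0 !mulr0.
rewrite /euler_step.
have := Vbound (euler_iter_mem m GW h0 hK) z.
set v := V _ z => vK; set y := iter _ _ _ z in IH *.
have -> : y + h * v - W z = (y - W z) + h * v by ring.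
apply: (le_trans (ler_normD _ _)); rewrite normrM (ger0_norm h0).
have : h * `|v| <= h * K by exact: ler_wpM2l.
by rewrite -natr1; lra.
Qed.

(** After [m] steps the iterate [y] is within [K * (h * m)] of [W], so the next step adds an error
    [h * (V y - V W)] of at most [L * K * h ^+ 2 * m]. The factor 1/2 that the summation over [m]
    would give is dropped. *)
Lemma euler_iter_taylor (h : R) W m : G W -> 0 <= h -> h * K <= 1 -> forall z,
  `|iter m (euler_step h) W z - W z - h * m%:R * V W z|
    <= L * K * (h * m%:R) ^+ 2.
Proof.
move=> GW h0 hK z; elim: m => [|m IH] /=.
  by rewrite subrr !(mulr0, mul0r, subr0) normr0 expr0n/= mulr0.
rewrite /euler_step.
have := Vlip (euler_iter_mem m GW h0 hK) GW (euler_iter_dist m GW h0 hK) z.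
set v := V (iter _ _ _) z; set y := iter _ _ _ z in IH *; set w := V W z in IH *.
move=> lip.
have -> : y + h * v - W z - h * m.+1%:R * w
   = (y - W z - h * m%:R * w) + h * (v - w) by rewrite -natr1; ring.
apply: (le_trans (ler_normD _ _)); rewrite normrM (ger0_norm h0).
have h1 : h * `|v - w| <= h * (L * (K * (h * m%:R))) by exact: ler_wpM2l.
apply: (le_trans (lerD IH h1)).
have h2 : 0 <= L * K * h ^+ 2 by rewrite !mulr_ge0.
have h3 : 0 <= L * K * h ^+ 2 * m%:R by rewrite mulr_ge0.
by rewrite -natr1; lra.
Qed.

Lemma euler_step_half (h : R) W : G W -> 0 <= h -> h * K <= 1 -> forall z,
  `|iter 2 (euler_step (h / 2)) W z - euler_step h W z| <= L * K * h ^+ 2.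
Proof.
move=> GW h0 hK z.
have h20 : 0 <= h / 2 by lra.
have h2K : h / 2 * K <= 1 by move: (mulr_ge0 h0 K0); lra.
have := Vlip (euler_iter_mem 1 GW h20 h2K) GW (euler_iter_dist 1 GW h20 h2K) z.
rewrite /= /euler_step.
set v := V _ z; set w := V W z => lip.
have -> : W z + h / 2 * w + h / 2 * v - (W z + h * w) = h / 2 * (v - w) by field.
rewrite normrM (ger0_norm h20); apply: (le_trans (ler_wpM2l h20 lip)).
have h2 : 0 <= L * K * h ^+ 2 by rewrite !mulr_ge0.
by lra.
Qed.

Lemma euler_step_lip (h : R) U W (e : R) : G U -> G W -> 0 <= h ->
  (forall z, `|U z - W z| <= e) ->
  forall z, `|euler_step h U z - euler_step h W z| <= (1 + h * L) * e.
Proof.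
move=> GU GW h0 hUW z; rewrite /euler_step.
have := Vlip GU GW hUW z; have := hUW z.
set v := V U z; set w := V W z => h1 h2.
have -> : U z + h * v - (W z + h * w) = (U z - W z) + h * (v - w) by ring.
apply: (le_trans (ler_normD _ _)); rewrite normrM (ger0_norm h0).
by have := ler_wpM2l h0 h2; lra.
Qed.

(** Halving one step costs [L * K * h ^+ 2] by [euler_step_half], and every later step amplifies an
    error by at most [1 + h * L] by [euler_step_lip]. The bound charges the largest amplification to
    each of the [m] errors. *)
Lemma euler_iter_refine (h : R) W m : G W -> 0 <= h -> h * K <= 1 -> forall z,
  `|iter (m * 2) (euler_step (h / 2)) W z - iter m (euler_step h) W z|
     <= L * K * h ^+ 2 * m%:R * (1 + h * L) ^+ m.
Proof.
move=> GW h0 hK.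
have h20 : 0 <= h / 2 by lra.
have h2K : h / 2 * K <= 1 by move: (mulr_ge0 h0 K0); lra.
have hL0 : 0 <= h * L by rewrite mulr_ge0.
elim: m => [|m IH] z; first by rewrite /= subrr normr0 mulr0 mul0r.
rewrite mulSn iterD.
rewrite [iter m.+1 _ _]/=; set U := iter (m * 2) _ W; set U' := iter m _ W.
have GU : G U by exact: euler_iter_mem.
have GU' : G U' by exact: euler_iter_mem.
have := euler_step_half GU h0 hK z.
have := euler_step_lip GU GU' h0 IH z.
set a := iter 2 _ _ z; set b := euler_step h U z; set c := euler_step h U' z.
move=> h1 h2.
have -> : a - c = (a - b) + (b - c) by ring.
apply: (le_trans (ler_normD _ _)); apply: (le_trans (lerD h2 h1)).
have h3 : 1 <= (1 + h * L) ^+ m.+1 by apply: exprn_ege1; lra.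
have h4 : 0 <= L * K * h ^+ 2 by rewrite !mulr_ge0.
have := ler_wpM2l h4 h3; rewrite -natr1 (exprS _ m).
set p := _ ^+ m; set q := L * K * h ^+ 2; set n := m%:R.
have -> : q * (n + 1) * ((1 + h * L) * p) =
  (1 + h * L) * (q * n * p) + q * ((1 + h * L) * p) by ring.
by lra.
Qed.

(** Dividing by [1 + K] instead of [K] keeps the mesh positive when [K] is 0, and the step condition
    [h * K <= 1] still holds. *)
Definition euler_mesh (n : nat) : R := (1 + K)^-1 / 2 ^+ n.

Definition euler_approx (n : nat) (W : Z -> R) (t : R) : Z -> R :=
  iter (Num.truncn (t / euler_mesh n)) (euler_step (euler_mesh n)) W.

Lemma euler_mesh_gt0 n : 0 < euler_mesh n.
Proof. by rewrite divr_gt0 ?exprn_gt0// invr_gt0 (ltr_wpDr K0). Qed.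

Lemma euler_mesh_le n : euler_mesh n * K <= 1.
Proof.
have k0 := K0; rewrite /euler_mesh; have h1 : 1 <= 2 ^+ n :> R by apply: exprn_ege1; lra.
rewrite -mulrA ler_pdivrMl ?mulr1; last by lra.
rewrite mulrC ler_pdivrMr ?exprn_gt0//.
have : (1 + K) * 1 <= (1 + K) * 2 ^+ n by apply: ler_wpM2l; lra.
by lra.
Qed.

Lemma euler_meshS n : euler_mesh n.+1 = euler_mesh n / 2.
Proof. by rewrite /euler_mesh exprS invfM; ring. Qed.

Lemma euler_mesh_cvg0 : euler_mesh @ \oo --> 0.
Proof.
have k0 := K0; rewrite /euler_mesh; have -> : (fun n => (1 + K)^-1 / 2 ^+ n) = 
   @geometric R (1 + K)^-1 (2^-1).
  by apply/funext => n /=; rewrite exprVn.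
by apply: cvg_geometric; rewrite gtr0_norm; lra.
Qed.

Lemma truncn_mesh_itv n (t : R) : 0 <= t ->
  euler_mesh n * (Num.truncn (t / euler_mesh n))%:R <= t
   /\ t < euler_mesh n * (Num.truncn (t / euler_mesh n))%:R + euler_mesh n.
Proof.
move=> t0; have m0 := euler_mesh_gt0 n.
have : 0 <= t / euler_mesh n by rewrite divr_ge0// ltW.
move=> /truncn_itv/andP[]; set q := Num.truncn _.
rewrite ler_pdivlMr// ltr_pdivrMr// -natr1 => h1 h2.
by split; lra.
Qed.

(** The first summand of the constant is the refinement error of the coarse steps, whose
    amplification is at most [expR (L * t)]. The summand [K] pays for the rounding of [t], which may
    add one fine step. *)
Lemma euler_approx_succ n W (t : R) : G W -> 0 <= t -> forall z,
  `|euler_approx n.+1 W t z - euler_approx n W t z|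
     <= (L * K * t * expR (L * t) + K) * euler_mesh n.
Proof.
move=> GW t0 z; have k0 := K0; have m0 := euler_mesh_gt0 n; have mK := euler_mesh_le n.
have m1 := euler_mesh_gt0 n.+1; have mK1 := euler_mesh_le n.+1.
rewrite /euler_approx.
have [h1 h2] := truncn_mesh_itv n t0; have [h3 h4] := truncn_mesh_itv n.+1 t0.
set q := Num.truncn (t / euler_mesh n) in h1 h2 *.
set q' := Num.truncn (t / euler_mesh n.+1) in h3 h4 *.
have h5 : q%:R * 2 < q'%:R + 1 :> R.
  by rewrite -(ltr_pM2l m1); move: h4; rewrite !euler_meshS => h4; lra.
have h6 : q'%:R < q%:R * 2 + 2 :> R.
  by rewrite -(ltr_pM2l m1); move: h3; rewrite !euler_meshS => h3; lra.
(* Rounding [t] down to the finer grid gives [q' = 2 * q] or [q' = 2 * q + 1]. *)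
have q2 : (q * 2 <= q')%N.
  by rewrite -ltnS -(ltr_nat R) natrM -natr1; lra.
have q3 : (q' - q * 2 <= 1)%N.
  have : (q' < q * 2 + 2)%N by rewrite -(ltr_nat R) natrD natrM; lra.
  lia.
rewrite -(subnK q2) iterD.
set U := iter (q * 2) _ W.
have GU : G U by apply: euler_iter_mem => //; exact: ltW.
have e1 := euler_iter_dist (q' - q * 2) GU (ltW m1) mK1 z.
have e2 := euler_iter_refine q GW (ltW m0) mK z.
rewrite -euler_meshS -/U in e2.
set a := iter _ _ U z in e1 *; set c := iter q _ _ z in e2 *.
have -> : a - c = (a - U z) + (U z - c) by ring.
apply: (le_trans (ler_normD _ _)).
have e3 : K * (euler_mesh n.+1 * (q' - q * 2)%:R) <= K * euler_mesh n.
  apply: ler_wpM2l => //; rewrite euler_meshS.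
  have : euler_mesh n / 2 * (q' - q * 2)%:R <= euler_mesh n / 2 * 1.
    by apply: ler_wpM2l; [lra|rewrite lern1].
  by lra.
have e4 : (1 + euler_mesh n * L) ^+ q <= expR (L * t).
  apply: (@le_trans _ _ (expR (euler_mesh n * L) ^+ q)).
    have := mulr_ge0 (ltW m0) L0 => ?.
    by apply: lerXn2r; rewrite ?nnegrE ?expR_ge0 ?expR_ge1Dx//; lra.
  rewrite -expRM_natr ler_expR.
  by have := ler_wpM2l L0 h1; lra.
have m00 := ltW m0; have p0 : 0 <= expR (L * t) by exact: expR_ge0.
have e5 : L * K * euler_mesh n ^+ 2 * q%:R * (1 + euler_mesh n * L) ^+ q
   <= L * K * t * expR (L * t) * euler_mesh n.
  apply: (@le_trans _ _ (L * K * euler_mesh n ^+ 2 * q%:R * expR (L * t))).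
    apply: ler_wpM2l e4; apply: mulr_ge0 => //.
    by apply: mulr_ge0; [exact: mulr_ge0|exact: sqr_ge0].
  have -> : L * K * euler_mesh n ^+ 2 * q%:R * expR (L * t) =
    (L * K * euler_mesh n * expR (L * t)) * (euler_mesh n * q%:R) by ring.
  have -> : L * K * t * expR (L * t) * euler_mesh n =
    (L * K * euler_mesh n * expR (L * t)) * t by ring.
  by apply: ler_wpM2l h1; apply: mulr_ge0 => //; apply: mulr_ge0 => //; exact: mulr_ge0.
by lra.
Qed.

Context (Gcvg : forall (F : nat -> Z -> R) (W : Z -> R), (forall n, G (F n)) ->
   (forall z, F ^~ z @ \oo --> W z) -> G W).

(** The bounds hold for the approximations up to errors that vanish with the mesh, and pass to the
    limit. [V] passes to the limit as well, since at a fixed time the convergence is uniform in [z]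
    and [V] is Lipschitz on [G]. *)
Theorem euler_flow W : G W -> exists u : R -> Z -> R,
  [/\ u 0 = W, forall t : R, 0 <= t -> G (u t),
      forall t h : R, 0 <= t -> 0 <= h -> forall z, `|u (t + h) z - u t z| <= K * h &
      forall t h : R, 0 <= t -> 0 <= h -> forall z,
        `|u (t + h) z - u t z - h * V (u t) z| <= L * K * h ^+ 2].
Proof.
move=> GW; have k0 := K0.
pose A t := 2 * (L * K * t * expR (L * t) + K).
have A0 (t : R) : 0 <= t -> 0 <= A t.
  by move=> t0; have := expR_ge0 (L * t) => ?; rewrite /A mulr_ge0// addr_ge0// !mulr_ge0.
have lim t z : exists l, 0 <= t ->
    forall n, `|euler_approx n W t z - l| <= A t * euler_mesh n.
  (* At negative times 0 is a dummy value, so that choice applies to all pairs [(t, z)]. *)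
  have [t0|] := leP 0 t; last by exists 0.
  have [||n|l hl] := @geometric_cauchy_lim R (fun n => euler_approx n W t z)
     (L * K * t * expR (L * t) + K) (1 + K)^-1.
  - by have := expR_ge0 (L * t) => ?; rewrite addr_ge0// !mulr_ge0.
  - by rewrite invr_ge0; lra.
  - exact: euler_approx_succ.
  - by exists l => _ n; exact: hl.
have {lim} /choice[u hu] : forall tz : R * Z, exists l, 0 <= tz.1 ->
    forall n, `|euler_approx n W tz.1 tz.2 - l| <= A tz.1 * euler_mesh n.
  by case=> t z; exact: lim.
have {}hu (t : R) z n : 0 <= t -> `|euler_approx n W t z - u (t, z)| <= A t * euler_mesh n.
  by move=> t0; exact: (hu (t, z)).
have Ga n t : G (euler_approx n W t).
  by apply: euler_iter_mem => //; [exact: ltW (euler_mesh_gt0 n)|exact: euler_mesh_le].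
have cvgAm c : (fun n => c * euler_mesh n) @ \oo --> 0.
  by rewrite -[X in _ --> X](mulr0 c); apply: cvgMr euler_mesh_cvg0.
have cvgu (t : R) z : 0 <= t -> (fun n => euler_approx n W t z) @ \oo --> u (t, z).
  move=> t0; apply/cvgrPdist_le => e e0.
  have /cvgrPdist_le/(_ e e0) := cvgAm (A t).
  apply: filterS => n; rewrite sub0r normrN => h.
  by rewrite distrC; apply: (le_trans (hu _ _ _ t0)); apply: le_trans h; exact: ler_norm.
have Gu (t : R) : 0 <= t -> G (fun z => u (t, z)).
  by move=> t0; apply: (@Gcvg (fun n => euler_approx n W t)) => // z; exact: cvgu.
(* The scheme at time [t + h] continues the one at time [t] by [m] steps, which cover [h] up to one
   mesh. Hence the estimates from the initial point of a scheme become estimates from any time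
   [t]. *)
have hK (t h : R) : 0 <= t -> 0 <= h -> forall n, exists2 m : nat,
    euler_approx n W (t + h) =
      iter m (euler_step (euler_mesh n)) (euler_approx n W t)
    & `|euler_mesh n * m%:R - h| <= euler_mesh n.
  move=> t0 h0 n; rewrite /euler_approx.
  have [h1 h2] := truncn_mesh_itv n t0.
  have [h3 h4] := truncn_mesh_itv n (addr_ge0 t0 h0).
  have m0 := euler_mesh_gt0 n.
  set q := Num.truncn (t / _) in h1 h2 *; set q' := Num.truncn _ in h3 h4 *.
  have qq : (q <= q')%N.
    by rewrite /q /q' le_truncn// ler_pM2r ?invr_gt0//; lra.
  exists (q' - q)%N; first by rewrite -iterD subnK.
  by rewrite natrB// ler_norml; apply/andP; split; lra.
exists (fun t z => u (t, z)); split => //.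
- apply/funext => z; apply: cvg_unique (cvgu 0 z (lexx 0)) _ => //.
  have -> : (fun n => euler_approx n W 0 z) = cst (W z).
    by apply/funext => n; rewrite /euler_approx mul0r truncn0.
  exact: cvg_cst.
- move=> t h t0 h0 z.
  have th0 : 0 <= t + h by exact: addr_ge0.
  apply: (@ler_cvg_to _ \oo _ _
    (fun n => `|euler_approx n W (t + h) z - euler_approx n W t z|)
    (fun n => K * h + K * euler_mesh n)).
  + by apply: cvg_norm; apply: cvgB; exact: cvgu.
  + by rewrite -[X in _ --> X]addr0; apply: cvgD => //; exact: cvg_cst.
  + apply: nearW => n; have [m -> hm] := hK t h t0 h0 n.
    have := euler_iter_dist m (Ga n t) (ltW (euler_mesh_gt0 n)) (euler_mesh_le n) z.
    move=> /le_trans; apply; rewrite -mulrDr; apply: ler_wpM2l => //.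
    by move: hm; rewrite ler_norml; lra.
- move=> t h t0 h0 z.
  have th0 : 0 <= t + h by exact: addr_ge0.
  have cvgV : (fun n => V (euler_approx n W t) z) @ \oo --> V (fun z => u (t, z)) z.
    apply/cvgrPdist_le => e e0.
    have /cvgrPdist_le/(_ e e0) := cvgAm (L * A t).
    apply: filterS => n; rewrite sub0r normrN => he.
    rewrite distrC; apply: le_trans he; apply: le_trans (ler_norm _).
    by rewrite -mulrA; apply: Vlip => //; [exact: Gu|move=> y; exact: hu].
  apply: (@ler_cvg_to _ \oo _ _
    (fun n => `|euler_approx n W (t + h) z - euler_approx n W t z
       - h * V (euler_approx n W t) z|)
    (fun n => L * K * ((h + euler_mesh n) * (h + euler_mesh n)) + K * euler_mesh n)).
  + apply: cvg_norm; apply: cvgB; first by apply: cvgB; exact: cvgu.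
    by apply: cvgMr.
  + rewrite -[X in _ --> X]addr0; apply: cvgD => //.
    have -> : h ^+ 2 = (h + 0) * (h + 0) by ring.
    apply: cvgMr.
    by apply: cvgM; (apply: cvgD; [exact: cvg_cst|exact: euler_mesh_cvg0]).
  + apply: nearW => n; have [m -> hm] := hK t h t0 h0 n.
    set U := euler_approx n W t.
    have m0 := euler_mesh_gt0 n.
    have := euler_iter_taylor m (Ga n t) (ltW m0) (euler_mesh_le n) z.
    rewrite -/U; set y := iter _ _ _ z; set v := V U z => h1.
    have -> : y - U z - h * v = (y - U z - euler_mesh n * m%:R * v)
       + (euler_mesh n * m%:R - h) * v by ring.
    apply: (le_trans (ler_normD _ _)); rewrite normrM; apply: lerD.
      apply: (le_trans h1); apply: ler_wpM2l; first exact: mulr_ge0.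
      have : 0 <= euler_mesh n * m%:R by rewrite mulr_ge0// ltW.
      move: hm; rewrite ler_norml -expr2 => /andP[_ hm] hm0.
      by apply: lerXn2r; rewrite ?nnegrE; lra.
    by rewrite mulrC; apply: ler_pM => //; apply: Vbound; exact: Ga.
Qed.

End euler_scheme.

(** * A Gronwall lemma for one-sided growth bounds *)

Lemma near_right0P (R : realType) (P : R -> Prop) :
  (\forall h \near 0^'+, P h) <->
  exists2 d, 0 < d & forall h, 0 < h -> h < d -> P h.
Proof.
split.
  move=> /nbhs_ballP[d d0 hd]; exists d => // h h0 hlt.
  by apply: hd => //; rewrite /ball/= sub0r normrN gtr0_norm.
move=> [d d0 hd]; apply/nbhs_ballP; exists d => //= h.
by rewrite /ball/= sub0r normrN => hlt h0; apply: hd => //; rewrite gtr0_norm in hlt.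
Qed.

Lemma near_dnbhs0P (R : realType) (P : R -> Prop) :
  (\forall h \near 0^', P h) <->
  exists2 d, 0 < d & forall h, h != 0 -> `|h| < d -> P h.
Proof.
split.
  move=> /nbhs_ballP[d d0 hd]; exists d => // h h0 hlt.
  by apply: hd => //; rewrite /ball/= sub0r normrN.
move=> [d d0 hd]; apply/nbhs_ballP; exists d => //= h.
by rewrite /ball/= sub0r normrN => hlt h0; exact: hd.
Qed.

(* The exponential barrier [eps * expR ((L + 1) * t)] cannot be crossed. *)
Lemma gronwall_eq0 (R : realType) (e : R -> R) (L T : R) : 0 <= L -> 0 <= T ->
  (forall s, 0 <= e s) -> e 0 = 0 ->
  (forall s, 0 < s -> s <= T -> exists2 c, 0 <= c &
     \forall h \near 0^', e s <= e (s + h) + `|h| * c) ->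
  (forall s, 0 <= s -> s < T -> e s <= 1 -> forall eps, 0 < eps ->
     \forall h \near 0^'+, e (s + h) <= e s + h * (L * e s + eps)) ->
  e T = 0.
Proof.
move=> L0 T0 e0 e00 econt eup.
pose C := expR ((L + 1) * T).
have C0 : 0 < C := expR_gt0 _.
(* It suffices to bound [e T] by the final height [eps * C] of every barrier of final height at most
   1: the height [min(e T / 2, 1)] then contradicts [0 < e T]. *)
suff bound eps : 0 < eps -> eps * C <= 1 -> e T <= eps * C.
  apply/eqP; rewrite eq_le e0 andbT leNgt; apply/negP => eT.
  pose m := Num.min (e T / 2) 1.
  have m0 : 0 < m by rewrite lt_min ltr01 andbT; lra.
  have := bound (m / C); rewrite divfK ?gt_eqF// divr_gt0// => /(_ isT).
  have m1 : m <= 1 by rewrite ge_min lexx orbT.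
  have m2 : m <= e T / 2 by rewrite ge_min lexx.
  by move=> /(_ m1); lra.
move=> eps0 epsC; pose phi t := eps * expR ((L + 1) * t).
have phi0 t : 0 < phi t by rewrite mulr_gt0// expR_gt0.
have phi_nd s t : s <= t -> phi s <= phi t.
  move=> st; apply: ler_wpM2l; first exact: ltW.
  by rewrite ler_expR; apply: ler_wpM2l => //; lra.
rewrite leNgt; apply/negP => eT.
pose A := [set t | [/\ 0 <= t, t <= T & phi t < e t]].
have AT : A T by split.
have lbA : lbound A 0 by move=> t [].
have hA : has_inf A by split; [exists T|exists 0].
(* This is the first crossing time. The function [e] is still below the barrier at [tau], hence also
   shortly after it, which contradicts the choice of [tau]. *)
pose tau := inf A.
have tau0 : 0 <= tau by apply: lb_le_inf => //; exists T.
have tauA t : A t -> tau <= t by move=> At; apply: ge_inf => //; exists 0.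
have tauT : tau <= T by exact: tauA.
have below s : 0 <= s -> s < tau -> e s <= phi s.
  move=> s0 st; rewrite leNgt; apply/negP => es.
  have /tauA : A s by split => //; lra.
  by lra.
have etau : e tau <= phi tau.
  rewrite leNgt; apply/negP => etau.
  have tau_gt0 : 0 < tau.
    rewrite lt_neqAle tau0 andbT; apply/eqP => t0; move: etau (phi0 tau).
    by rewrite -t0 e00; lra.
  have [c c0 /near_dnbhs0P[d d0 hd]] := econt _ tau_gt0 tauT.
  pose g := e tau - phi tau; have g0 : 0 < g by rewrite /g; lra.
  (* A step back of length [h] loses at most [h * c], which must stay below the gap [g]. The
     denominator [c + 1] makes this strict and is nonzero when [c] is 0. *)
  have gc : 0 < g / (c + 1) by rewrite divr_gt0//; lra.
  pose h := Num.min (d / 2) (Num.min tau (g / (c + 1))).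
  have h0 : 0 < h by rewrite !lt_min tau_gt0 gc; lra.
  have hd2 : h <= d / 2 by rewrite ge_min lexx.
  have htau : h <= tau by rewrite !ge_min lexx orbT.
  have hg : h <= g / (c + 1) by rewrite !ge_min lexx !orbT.
  have : e tau <= e (tau - h) + `|- h| * c.
    by apply: hd; rewrite ?oppr_eq0 ?gt_eqF// normrN gtr0_norm//; lra.
  rewrite normrN gtr0_norm//.
  have : e (tau - h) <= phi (tau - h) by apply: below; lra.
  have : phi (tau - h) <= phi tau by apply: phi_nd; lra.
  have : h * (c + 1) <= g by rewrite -ler_pdivlMr//; lra.
  by rewrite /g; lra.
have tau_lt : tau < T.
  rewrite lt_neqAle tauT andbT; apply/eqP => tT.
  by move: etau; rewrite tT; rewrite /phi -/C in eT *; lra.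
have phi1 : phi tau <= 1 by apply: le_trans epsC; exact: phi_nd.
(* With the slack [eps] taken to be [phi tau], the growth rate of [e] is at most
   [(L + 1) * phi tau], the slope of the barrier at [tau]. *)
have [d d0 hd] : exists2 d, 0 < d & forall h, 0 < h -> h < d ->
    e (tau + h) <= e tau + h * (L * e tau + phi tau).
  by apply/near_right0P; apply: eup => //; lra.
have : tau + d <= tau.
  apply: lb_le_inf; first by exists T.
  move=> t At; rewrite leNgt; apply/negP => td.
  have := tauA _ At; rewrite le_eqVlt => /predU1P[tt|tt].
    by case: At => _ _; rewrite -tt; lra.
  case: At => _ _; apply/negP; rewrite -leNgt.
  have -> : t = tau + (t - tau) by ring.
  set h := t - tau; have h0 : 0 < h by rewrite /h; lra.
  have hdd : h < d by rewrite /h; lra.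
  apply: (le_trans (hd _ h0 hdd)).
  have : L * e tau <= L * phi tau by exact: ler_wpM2l.
  move=> /(ler_wpM2l (ltW h0)) h1.
  have : phi tau * (1 + (L + 1) * h) <= phi tau * expR ((L + 1) * h).
    by apply: ler_wpM2l; [exact: ltW|exact: expR_ge1Dx].
  have -> : phi tau * expR ((L + 1) * h) = phi (tau + h).
    by rewrite /phi -mulrA -expRD -mulrDr.
  by lra.
by lra.
Qed.

(** * Iterated integrals of bounded functions *)

Section multi_integral_theory.
Context d (T : measurableType d) (R : realType) (P : probability T R) (k : nat).
Implicit Types (f g : ('I_k -> T) -> R) (x y : 'I_k -> T) (s : seq 'I_k).

(* Joint measurability in all coordinates, without a sigma-algebra on ['I_k -> T]. *)
Definition coord_measurable f := forall d' (T' : measurableType d')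
  (x : T' -> 'I_k -> T), (forall i, measurable_fun setT (fun t => x t i)) ->
  measurable_fun setT (fun t => f (x t)).

(** The class contains the induced densities of bounded measurable functions and is closed under
    integrating out a coordinate, so every stage of an iterated integral stays in it. *)
Definition tame f := coord_measurable f /\ exists B : R, forall x, `|f x| <= B.

Lemma tame_cst (c : R) : tame (fun=> c).
Proof. by split=> [? ? ? _|]; [exact: measurable_cst|exists `|c|]. Qed.

Lemma tameB f g : tame f -> tame g -> tame (fun x => f x - g x).
Proof.
move=> [mf [B hB]] [mg [C hC]]; split.
  by move=> d' T' x mx; apply: measurable_funB; [exact: mf|exact: mg].
exists (B + C) => x; apply: (le_trans (ler_normB _ _)); exact: lerD.
Qed.

Lemma tameD f g : tame f -> tame g -> tame (fun x => f x + g x).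
Proof.
move=> [mf [B hB]] [mg [C hC]]; split.
  by move=> d' T' x mx; apply: measurable_funD; [exact: mf|exact: mg].
exists (B + C) => x; apply: (le_trans (ler_normD _ _)); exact: lerD.
Qed.

Lemma tameM f g : tame f -> tame g -> tame (fun x => f x * g x).
Proof.
move=> [mf [B hB]] [mg [C hC]]; split.
  by move=> d' T' x mx; apply: measurable_funM; [exact: mf|exact: mg].
by exists (B * C) => x; rewrite normrM ler_pM.
Qed.

Lemma tame_prod (I : Type) (r : seq I) (Q : pred I) (f : I -> ('I_k -> T) -> R) :
  (forall i, Q i -> tame (f i)) -> tame (fun x => \prod_(i <- r | Q i) f i x).
Proof.
move=> tf; elim: r => [|i r IH].
  by under eq_fun do rewrite big_nil; exact: tame_cst.
under eq_fun do rewrite big_cons; case: (boolP (Q i)) => // Qi.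
by apply: tameM => //; exact: tf.
Qed.

Lemma tame_sum (I : Type) (r : seq I) (Q : pred I) (f : I -> ('I_k -> T) -> R) :
  (forall i, Q i -> tame (f i)) -> tame (fun x => \sum_(i <- r | Q i) f i x).
Proof.
move=> tf; elim: r => [|i r IH].
  by under eq_fun do rewrite big_nil; exact: tame_cst.
under eq_fun do rewrite big_cons; case: (boolP (Q i)) => // Qi.
by apply: tameD => //; exact: tf.
Qed.

Lemma tame_pair (W : T * T -> R) (B : R) i j : measurable_fun setT W ->
  (forall z, `|W z| <= B) -> tame (fun x => W (x i, x j)).
Proof.
move=> mW WB; split; last by exists B.
move=> d' T' x mx; apply: (measurableT_comp mW).
by apply/measurable_fun_pairP; split; exact: mx.
Qed.

Lemma tame_induced_density (F : graph k) (W : T * T -> R) (B : R) :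
  measurable_fun setT W -> (forall z, `|W z| <= B) -> tame (induced_density F W).
Proof.
move=> mW WB; apply: tame_prod => i _; apply: tame_prod => j _.
have tW := tame_pair i j mW WB.
by case: (adj F i j) => //; apply: tameB => //; exact: tame_cst.
Qed.

Lemma tame_slice f i x : tame f ->
  measurable_fun setT (fun z : T => f [eta x with i |-> z]).
Proof.
move=> [mf _]; apply: mf => j /=.
by case: (j == i); [exact: measurable_id|exact: measurable_cst].
Qed.

Lemma tame_integrable f i x : tame f ->
  P.-integrable setT (EFin \o (fun z : T => f [eta x with i |-> z])).
Proof.
move=> tf; apply: measurable_bounded_integrable => //.
- by rewrite [ltLHS]probability_setT ltry.
- exact: tame_slice.
- have [_ [B hB]] := tf.
  by exists B; split; [exact: num_real|move=> y By z _; exact: le_trans (ltW By)].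
Qed.

Lemma Rintegral_prob_cst (c : R) : \int[P]_(z in setT) c = c.
Proof. by rewrite Rintegral_cst// [X in fine X]probability_setT mulr1. Qed.

Lemma tame_Rintegral f i : tame f ->
  tame (fun x => \int[P]_z f [eta x with i |-> z]).
Proof.
move=> tf; have [mf [B hB]] := tf; split; last first.
  exists B => x; have intf := tame_integrable i x tf.
  apply: (le_trans (le_normr_Rintegral _ intf)) => //.
  rewrite -[leRHS]Rintegral_prob_cst; apply: le_Rintegral => //.
  - exact: integrable_norm.
  - exact: (tame_integrable i x (tame_cst B)).
move=> d' T' x mx.
(* Adding the bound [B] makes the integrand nonnegative, so that Tonelli's theorem gives
   measurability in the parameter. *)
have -> : (fun t => \int[P]_z f [eta x t with i |-> z]) =
   (fun t => \int[P]_z (f [eta x t with i |-> z] + B) - B).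
  apply/funext => t; rewrite RintegralD//; last 2 first.
  - exact: tame_integrable.
  - exact: (tame_integrable i (x t) (tame_cst B)).
  by rewrite Rintegral_prob_cst addrK.
apply: measurable_funB; last exact: measurable_cst.
apply: (measurableT_comp (fine_measurable measurableT)).
pose g (tz : T' * T) := (f [eta x tz.1 with i |-> tz.2] + B)%:E.
apply: (@measurable_fun_fubini_tonelli_F _ _ _ _ _ P g).
- apply/measurable_EFinP; apply: measurable_funD; last exact: measurable_cst.
  apply: mf => j /=; case: (j == i); first exact: measurable_snd.
  exact: (measurableT_comp (mx j) measurable_fst).
- move=> z; rewrite lee_fin; have := hB [eta x z.1 with i |-> z.2].
  by rewrite ler_norml; lra.
Qed.

Lemma tame_multi_integral s f : tame f -> tame (multi_integral P s f).
Proof. by move=> tf; elim: s => //= i s IH; exact: tame_Rintegral. Qed.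

Lemma le_multi_integral s f g : tame f -> tame g -> (forall x, f x <= g x) ->
  forall x, multi_integral P s f x <= multi_integral P s g x.
Proof.
move=> tf tg fg; elim: s => //= i s IH x.
by apply: le_Rintegral => //; apply: tame_integrable; exact: tame_multi_integral.
Qed.

Lemma multi_integral_cst s f x :
  (forall y i z, i \in s -> f [eta y with i |-> z] = f y) ->
  multi_integral P s f x = f x.
Proof.
move=> hf; elim: s hf x => //= i s IH hf x.
rewrite -[RHS]Rintegral_prob_cst; apply: eq_Rintegral => z _.
by rewrite IH ?hf ?mem_head// => y j w js; rewrite hf// inE js orbT.
Qed.

Lemma multi_integralD s f g x : tame f -> tame g ->
  multi_integral P s (fun x => f x + g x) x =
  multi_integral P s f x + multi_integral P s g x.
Proof.
move=> tf tg; elim: s x => //= i s IH x.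
under eq_Rintegral do rewrite IH.
by rewrite RintegralD//; apply: tame_integrable; exact: tame_multi_integral.
Qed.

Lemma multi_integral_sum (I : Type) (r : seq I) (Q : pred I)
    (f : I -> ('I_k -> T) -> R) s x : (forall i, tame (f i)) ->
  multi_integral P s (fun x => \sum_(i <- r | Q i) f i x) x =
  \sum_(i <- r | Q i) multi_integral P s (f i) x.
Proof.
move=> tf; elim: r => [|i r IH].
  rewrite big_nil; under [X in multi_integral P s X]eq_fun do rewrite big_nil.
  by rewrite multi_integral_cst.
rewrite big_cons; under [X in multi_integral P s X]eq_fun do rewrite big_cons.
case: (boolP (Q i)) => // Qi; rewrite multi_integralD ?IH//; exact: tame_sum.
Qed.

(** This is monotonicity applied to [f <= g + e] and [g <= f + e], as constants integrate to
    themselves under a probability. *)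
Lemma multi_integral_dist s f g (e : R) : tame f -> tame g ->
  (forall x, `|f x - g x| <= e) ->
  forall x, `|multi_integral P s f x - multi_integral P s g x| <= e.
Proof.
move=> tf tg fg x.
have cstE : multi_integral P s (fun=> e) x = e by rewrite multi_integral_cst.
have h1 : multi_integral P s f x <= multi_integral P s (fun x => g x + e) x.
  apply: le_multi_integral => //; first by apply: tameD => //; exact: tame_cst.
  by move=> y; have := fg y; rewrite ler_norml; lra.
have h2 : multi_integral P s g x <= multi_integral P s (fun x => f x + e) x.
  apply: le_multi_integral => //; first by apply: tameD => //; exact: tame_cst.
  by move=> y; have := fg y; rewrite ler_norml; lra.
move: h1 h2; rewrite !multi_integralD ?cstE//; [|exact: tame_cst..].
by rewrite ler_norml; lra.
Qed.

Lemma multi_integral_local s f x y : (forall i, i \notin s -> x i = y i) ->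
  multi_integral P s f x = multi_integral P s f y.
Proof.
elim: s x y => [|i s IH] x y xy /=.
  by congr f; apply/funext => i; exact: xy.
apply: eq_Rintegral => z _; apply: IH => j js /=.
by case: eqP => // /eqP ji; apply: xy; rewrite inE negb_or ji.
Qed.

(** * Invariance of iterated integrals under changes on a null set *)

Section almost_everywhere.
Context (N : set (T * T)) (mN : measurable N) (N0 : (P \x P)%E N = 0).

Definition null_sections (t : T) :=
  P (xsection N t) = 0 /\ P (ysection N t) = 0.

(** The measures of the sections of [N] are nonnegative functions with integral [(P \x P) N = 0], in
    either order of integration. *)
Lemma ae_null_sections : {ae P, forall t, null_sections t}.
Proof.
have hx : (\int[P]_x `|P (xsection N x)|)%E = 0.
  rewrite -[RHS]N0 /product_measure1; apply: eq_integral => t _ /=.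
  by rewrite gee0_abs.
have hy : (\int[P]_y `|P (ysection N y)|)%E = 0.
  rewrite -[RHS]N0 /product_measure1.
  have := indic_fubini_tonelli P P mN.
  rewrite indic_fubini_tonelli_FE// indic_fubini_tonelli_GE// => ->.
  by apply: eq_integral => t _ /=; rewrite gee0_abs.
move/ae_eq_integral_abs : hx => /(_ measurableT (measurable_fun_xsection P mN)) hx.
move/ae_eq_integral_abs : hy => /(_ measurableT (measurable_fun_ysection P mN)) hy.
by apply: filterS2 hx hy => t /(_ Logic.I) h1 /(_ Logic.I) h2; split.
Qed.

(** Induction invariant for the coordinates fixed so far, those indexed by [S]. The second clause is
    what the integrand needs; the first allows one more coordinate to be fixed. *)
Definition off_null (S : {set 'I_k}) x :=
  (forall i, i \in S -> null_sections (x i)) /\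
  (forall i j, i \in S -> j \in S -> i != j -> ~ N (x i, x j)).

(** Almost every [z] has null sections itself and avoids the finitely many null sections of [N] at
    the points [x j] with [j] in [S]. *)
Lemma off_null_extend (S : {set 'I_k}) x i : i \notin S -> off_null S x ->
  {ae P, forall z, off_null (i |: S)%SET [eta x with i |-> z]}.
Proof.
move=> iS [hs hN].
have h1 : {ae P, forall z, forall j, j \in S -> ~ N (x j, z) /\ ~ N (z, x j)}.
  apply: filter_forall => j; have [jS|jS] := boolP (j \in S); last first.
    by apply: aeW.
  have [h1 h2] := hs _ jS.
  have n1 : {ae P, forall z, ~ xsection N (x j) z}.
    by apply/(@negligibleP _ _ _ P); rewrite setCK//; exact: measurable_xsection.
  have n2 : {ae P, forall z, ~ ysection N (x j) z}.
    by apply/(@negligibleP _ _ _ P); rewrite setCK//; exact: measurable_ysection.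
  apply: filterS2 n1 n2 => z; rewrite /xsection /ysection /=.
  by move=> z1 z2 _; split=> hz; [apply: z1|apply: z2]; rewrite inE.
apply: filterS2 ae_null_sections h1 => z gz hz; split.
  move=> j; rewrite !inE /=; case: eqP => //= _; exact: hs.
move=> j l; rewrite !inE /=; case: eqP => [->|_]; case: eqP => [->|_] //=.
- by rewrite eqxx.
- by move=> _ lS _; exact: (hz _ lS).2.
- by move=> jS _ _; exact: (hz _ jS).1.
- exact: hN.
Qed.

(** Each integral that is peeled off moves its index from [s] to [S], for almost every value of the
    variable. At the end all coordinates are fixed off [N], where the integrands agree. *)
Lemma eq_multi_integral_ae f g s (S : {set 'I_k}) x : tame f -> tame g ->
  uniq s -> (forall i, i \in s -> i \notin S) ->
  (forall i, i \in S \/ i \in s) ->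
  (forall y, off_null [set: 'I_k]%SET y -> f y = g y) ->
  off_null S x -> multi_integral P s f x = multi_integral P s g x.
Proof.
move=> tf tg + + + fg; elim: s S x => [|i s IH] S x /=.
  move=> _ _ allS ox; apply: fg; suff <- : S = [set: 'I_k]%SET by [].
  by apply/setP => i; rewrite inE; case: (allS i).
move=> /andP[iNs us] sS allS ox.
congr fine; apply: ae_eq_integral => //.
- by apply/measurable_EFinP; apply: tame_slice; exact: tame_multi_integral.
- by apply/measurable_EFinP; apply: tame_slice; exact: tame_multi_integral.
have iS : i \notin S by apply: sS; exact: mem_head.
apply: filterS (off_null_extend iS ox) => z oz _; congr EFin.
apply: (IH (i |: S)%SET) => //.
- move=> j js; rewrite !inE negb_or sS ?andbT ?inE ?js ?orbT//.
  by apply: contraNneq iNs => <-.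
- move=> j; have [jS|] := allS j; first by left; rewrite !inE jS orbT.
  by rewrite inE => /predU1P[->|]; [left; rewrite !inE eqxx|right].
Qed.

End almost_everywhere.

Lemma ae_prod_coord (Q : T -> Prop) : {ae P, forall t, Q t} ->
  {ae (P \x P)%E, forall z, Q z.1 /\ Q z.2}.
Proof.
move=> [A [mA A0 QA]].
have h1 : {ae (P \x P)%E, forall z : T * T, Q z.1}.
  exists (A `*` setT); split; first exact: measurableX.
    by rewrite product_measure1E// [X in (X * _)%E]A0 mul0e.
  by move=> z nz; split => //; exact: QA.
have h2 : {ae (P \x P)%E, forall z : T * T, Q z.2}.
  exists (setT `*` A); split; first exact: measurableX.
    by rewrite product_measure1E// [X in (_ * X)%E]A0 mule0.
  by move=> z nz; split => //; exact: QA.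
by apply: filterS2 h1 h2.
Qed.

(** Integrating the sections of [N] in the other order computes the measure of the swapped set. *)
Lemma null_swap (N : set (T * T)) : measurable N -> (P \x P)%E N = 0 ->
  {ae (P \x P)%E, forall z, ~ N (z.2, z.1)}.
Proof.
move=> mN N0.
have mN' : measurable ((fun z : T * T => (z.2, z.1)) @^-1` N).
  rewrite -[X in measurable X]setTI.
  by apply: (@measurable_swap _ _ T T measurableT).
apply/(@negligibleP _ _ _ (P \x P)%E); rewrite setCK//.
rewrite -[RHS]N0.
have := indic_fubini_tonelli P P mN.
by rewrite indic_fubini_tonelli_FE// indic_fubini_tonelli_GE.
Qed.

(** For almost every [z] the two roots have null sections and both [z] and its swap avoid [N]. This
    is the invariant [off_null] for [[set a; b]], from which the induction over the other
    coordinates starts. *)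
Lemma rooted_density_ae (F : graph k) (a b : 'I_k) (U W : T * T -> R)
    (B B' : R) : a != b ->
  measurable_fun setT U -> measurable_fun setT W ->
  (forall z, `|U z| <= B) -> (forall z, `|W z| <= B') ->
  {ae (P \x P)%E, forall z, U z = W z} ->
  {ae (P \x P)%E, forall z, rooted_density P F a b U z = rooted_density P F a b W z}.
Proof.
move=> ab mU mW UB WB' [N [mN N0 UW]].
have {}UW z : ~ N z -> U z = W z by move=> nz; apply: contrapT => /UW.
have hN : {ae (P \x P)%E, forall z, ~ N z}.
  by apply/(@negligibleP _ _ _ (P \x P)%E); rewrite setCK.
apply: filterS3 (ae_prod_coord (ae_null_sections mN N0)) hN (null_swap mN N0).
move=> z [g1 g2] z1 z2; rewrite /rooted_density.
have coords i : i \in [set a; b]%SET ->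
    (i = a /\ [eta (fun=> z.1) with b |-> z.2] i = z.1) \/
    (i = b /\ [eta (fun=> z.1) with b |-> z.2] i = z.2).
  rewrite !inE /= => /orP[/eqP->|/eqP->]; [left|right]; rewrite ?eqxx//.
  by rewrite (negbTE ab).
apply: (@eq_multi_integral_ae N mN N0 _ _ _ [set a; b]%SET).
- exact: tame_induced_density UB.
- exact: tame_induced_density WB'.
- exact: enum_uniq.
- by move=> i; rewrite mem_enum inE.
- by move=> i; rewrite mem_enum [i \in ~: _]inE; apply/orP; exact: orbN.
- move=> y [_ hy]; apply: eq_bigr => i _; apply: eq_bigr => j ij.
  by rewrite !UW//; apply: hy; rewrite ?inE// neq_ltn ij.
- split.
    by move=> i /coords[[_ ->]|[_ ->]].
  move=> i j /coords[[-> ->]|[-> ->]] /coords[[-> ->]|[-> ->]]; rewrite ?eqxx//.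
  by move=> _; rewrite -surjective_pairing.
Qed.

Lemma velocity_ae (r : graph k -> graph k -> R) (U W : T * T -> R) (B B' : R) :
  measurable_fun setT U -> measurable_fun setT W ->
  (forall z, `|U z| <= B) -> (forall z, `|W z| <= B') ->
  {ae (P \x P)%E, forall z, U z = W z} ->
  {ae (P \x P)%E, forall z, velocity P r U z = velocity P r W z}.
Proof.
move=> mU mW UB WB' UW.
have : {ae (P \x P)%E, forall z, forall (Fab : graph k * 'I_k * 'I_k),
   Fab.1.2 != Fab.2 ->
   rooted_density P Fab.1.1 Fab.1.2 Fab.2 U z = rooted_density P Fab.1.1 Fab.1.2 Fab.2 W z}.
  apply: filter_forall => -[[F a] b] /=; have [->|ab] := eqVneq a b.
    by apply: aeW.
  by apply: filterS (rooted_density_ae F ab mU mW UB WB' UW) => z.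
apply: filterS => z hz; apply: eq_bigr => F _; apply: eq_bigr => H _.
congr (_ * _); apply: eq_bigr => a _; apply: eq_bigr => b ab.
by rewrite (hz (F, a, b)).
Qed.

Lemma measurable_rooted_density (F : graph k) a b (W : T * T -> R) (B : R) :
  measurable_fun setT W -> (forall z, `|W z| <= B) ->
  measurable_fun setT (rooted_density P F a b W).
Proof.
move=> mW WB; rewrite /rooted_density.
have [+ _] := tame_multi_integral (enum (~: [set a; b])%SET) (tame_induced_density F mW WB).
apply => i /=; case: (i == b); [exact: measurable_snd|exact: measurable_fst].
Qed.

Lemma measurable_velocity (r : graph k -> graph k -> R) (W : T * T -> R) (B : R) :
  measurable_fun setT W -> (forall z, `|W z| <= B) ->
  measurable_fun setT (velocity P r W).
Proof.
move=> mW WB; apply: measurable_sum => F; apply: measurable_sum => H.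
apply: measurable_funM; first exact: measurable_cst.
apply: measurable_sum => a; under eq_fun do rewrite big_mkcond.
apply: measurable_sum => b; case: (boolP (a != b)) => // _.
apply: measurable_funM; last exact: measurable_cst.
exact: measurable_rooted_density WB.
Qed.

End multi_integral_theory.

(** * Bounds on the velocity operator *)

(** Factors are exchanged one at a time. The assumption [1 <= B] absorbs the missing factor, so the
    exponent is the full length. *)
Lemma prod_dist_seq (R : realType) (I : Type) (r : seq I) (f g : I -> R) (B e : R) :
  1 <= B -> (forall i, `|f i| <= B) -> (forall i, `|g i| <= B) ->
  (forall i, `|f i - g i| <= e) ->
  `|\prod_(i <- r) f i - \prod_(i <- r) g i| <= B ^+ size r * ((size r)%:R * e).
Proof.
move=> B1 fB gB fg.
suff [//] : `|\prod_(i <- r) f i - \prod_(i <- r) g i|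
    <= B ^+ size r * ((size r)%:R * e) /\ `|\prod_(i <- r) g i| <= B ^+ size r.
elim: r => [|i r [IH1 IH2]].
  by rewrite !big_nil /= subrr normr0 mul0r mulr0 normr1.
have B0 : 0 <= B by lra.
rewrite !big_cons /=; set p := \prod_(_ <- _) _ in IH1 *.
set q := \prod_(_ <- _) _ in IH1 IH2 *; split; last first.
  by rewrite normrM exprS ler_pM.
have -> : f i * p - g i * q = f i * (p - q) + (f i - g i) * q by ring.
have e0 : 0 <= e by exact: le_trans (normr_ge0 _) (fg i).
apply: (le_trans (ler_normD _ _)); rewrite !normrM.
have h1 : `|f i| * `|p - q| <= B * (B ^+ size r * ((size r)%:R * e)) by exact: ler_pM.
have h2 : `|f i - g i| * `|q| <= e * B ^+ size r by exact: ler_pM.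
have h3 : e * B ^+ size r <= e * B ^+ (size r).+1.
  by apply: ler_wpM2l => //; rewrite exprS ler_peMl// exprn_ge0.
move: h3; rewrite -natr1 (exprS _ (size r)) => h3.
by lra.
Qed.

Lemma prod_dist (R : realType) (I : finType) (Q : pred I) (f g : I -> R) (B e : R) :
  1 <= B -> (forall i, `|f i| <= B) -> (forall i, `|g i| <= B) ->
  (forall i, `|f i - g i| <= e) ->
  `|\prod_(i | Q i) f i - \prod_(i | Q i) g i| <= B ^+ #|Q| * (#|Q|%:R * e).
Proof.
move=> B1 fB gB fg; rewrite cardE -![\prod_(i | Q i) _]big_enum.
exact: prod_dist_seq.
Qed.

Lemma sum_neq_pairs (R : realType) (k : nat) (c : R) :
  \sum_(a < k) \sum_(b < k | a != b) c = (k ^_ 2)%:R * c.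
Proof.
under eq_bigr => a _.
  rewrite sumr_const (_ : #|_| = k.-1); last first.
    transitivity #|predC1 a|; first by apply: eq_card => b; rewrite !inE eq_sym.
    by rewrite cardC1 card_ord.
  over.
by rewrite sumr_const card_ord -mulrnA -[LHS]mulr_natl ffactnS ffactn1 mulnC.
Qed.

(** * Sums over graphs as products over edges *)

Section graph_sums.
Context (R : realType) (k : nat).

Lemma set2_lt_inj (i j i' j' : 'I_k) : (i < j)%N -> (i' < j')%N ->
  [set i; j]%SET = [set i'; j']%SET -> (i, j) = (i', j').
Proof.
move=> ij ij' /setP E.
have : i \in [set i'; j']%SET by rewrite -E !inE eqxx.
have : j \in [set i'; j']%SET by rewrite -E !inE eqxx orbT.
rewrite !inE => /orP[]/eqP ej /orP[]/eqP ei; rewrite ei ej//.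
- by move: ij; rewrite ei ej ltnn.
- by move: ij; rewrite ei ej => /(ltn_trans ij'); rewrite ltnn.
- by move: ij; rewrite ei ej ltnn.
Qed.

Lemma prod_lt_pairs (f : {set 'I_k} -> R) :
  \prod_(i < k) \prod_(j < k | (i < j)%N) f [set i; j]%SET =
  \prod_(e : {set 'I_k} | #|e| == 2%N) f e.
Proof.
rewrite pair_big_dep /=.
pose h (p : 'I_k * 'I_k) := [set p.1; p.2]%SET.
pose A := [set p : 'I_k * 'I_k | (p.1 < p.2)%N]%SET.
have hA : (h @: A)%SET = [set e : {set 'I_k} | #|e| == 2%N]%SET.
  apply/setP => e; rewrite inE; apply/imsetP/cards2P.
    move=> [[i j]]; rewrite inE /= => ij ->; exists i, j; split => //.
    by rewrite neq_ltn ij.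
  move=> [i [j [ij ->]]]; move: ij; rewrite neq_ltn => /orP[ij|ij].
    by exists (i, j); rewrite ?inE.
  by exists (j, i); rewrite ?inE// /h/= finset.setUC.
transitivity (\prod_(e in (h @: A)%SET) f e); last first.
  by apply: eq_bigl => e; rewrite hA inE.
rewrite big_imset /=; first by apply: eq_bigl => p; rewrite inE.
move=> [i j] [i' j']; rewrite !inE /h /= => ij ij'.
exact: set2_lt_inj.
Qed.

Lemma sum_graph_prod (w v : {set 'I_k} -> R) :
  \sum_(F : graph k) \prod_(e : {set 'I_k} | #|e| == 2%N)
     (if e \in val F then w e else v e) =
  \prod_(e : {set 'I_k} | #|e| == 2%N) (w e + v e).
Proof.
(* With weights 0 and 1 off the 2-element sets, the sum extends to all families of subsets, where
   full distributivity applies; a family that is not a graph contributes 0. *)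
pose w' (e : {set 'I_k}) := if #|e| == 2%N then w e else 0.
pose v' (e : {set 'I_k}) := if #|e| == 2%N then v e else 1.
transitivity (\prod_(e : {set 'I_k}) (w' e + v' e)); last first.
  rewrite [RHS]big_mkcond; apply: eq_bigr => e _; rewrite /w' /v'.
  by case: ifP => // _; rewrite add0r.
pose G (E : {set {set 'I_k}}) := \prod_e (if e \in E then w' e else v' e).
have -> : \prod_(e : {set 'I_k}) (w' e + v' e) = \sum_(E : {set {set 'I_k}}) G E.
  by rewrite bigA_distr; apply: eq_bigl => E; rewrite inE.
pose Q (E : {set {set 'I_k}}) := [forall e in E, #|e| == 2%N].
rewrite [RHS](bigID Q) /= [X in _ + X]big1 ?addr0; last first.
  move=> E; rewrite negb_forall => /existsP[e]; rewrite negb_imply => /andP[eE e2].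
  by rewrite /G (bigD1 e)//= eE /w' (negbTE e2) mul0r.
transitivity (\sum_(F : graph k) G (val F)).
  apply: eq_bigr => F _; rewrite /G big_mkcond; apply: eq_bigr => e _.
  rewrite /w' /v'; case: (boolP (#|e| == 2%N)) => // e2; case: ifP => // eF.
  by have /forall_inP/(_ e eF) := valP F; rewrite (negbTE e2).
have Q0 : Q finset.set0 by apply/forall_inP => e; rewrite finset.in_set0.
pose F0 : graph k := exist _ finset.set0 Q0.
rewrite (reindex_onto (fun F : graph k => val F) (insubd F0)); last first.
  by move=> E QE; rewrite insubdK.
apply: eq_bigl => F; rewrite valKd eqxx andbT; apply/esym; exact: (valP F).
Qed.

Lemma card_2sets : #|[pred e : {set 'I_k} | #|e| == 2%N]| = 'C(k, 2).
Proof. by rewrite -[in RHS](card_ord k) -card_draws cardsE. Qed.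

Lemma card_graph : (#|{: graph k}|%:R : R) = 2 ^+ 'C(k, 2).
Proof.
have := sum_graph_prod (fun=> 1) (fun=> 1).
rewrite (eq_bigr (fun=> 1)) => [|F _]; last by apply: big1 => e _; case: ifP.
by rewrite sumr_const prodr_const card_2sets => ->.
Qed.

Context d (T : measurableType d).
Implicit Types (W : T * T -> R) (x : 'I_k -> T).

(** The increasing pair makes this a function of the unordered edge without any symmetry of [W], in
    agreement with the range [i < j] in [induced_density]. *)
Definition edge_weight W x (e : {set 'I_k}) : R :=
  if [pick p : 'I_k * 'I_k | (p.1 < p.2)%N && (e == [set p.1; p.2]%SET)]
    is Some p then W (x p.1, x p.2) else 0.

Lemma edge_weightE W x (i j : 'I_k) : (i < j)%N ->
  edge_weight W x [set i; j]%SET = W (x i, x j).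
Proof.
move=> ij; rewrite /edge_weight; case: pickP => [[i' j']/= /andP[ij' /eqP E]|].
  by have [-> ->] := set2_lt_inj ij ij' E.
by move=> /(_ (i, j)); rewrite /= ij eqxx.
Qed.

Lemma induced_densityE (F : graph k) W x : induced_density F W x =
  \prod_(e : {set 'I_k} | #|e| == 2%N)
    (if e \in val F then edge_weight W x e else 1 - edge_weight W x e).
Proof.
rewrite -prod_lt_pairs; apply: eq_bigr => i _; apply: eq_bigr => j ij.
by rewrite edge_weightE.
Qed.

(** The sum factors over the edges, with factors [w + (1 - w)]. *)
Lemma sum_induced_density W x : \sum_(F : graph k) induced_density F W x = 1.
Proof.
under eq_bigr do rewrite induced_densityE.
by rewrite sum_graph_prod big1// => e _; rewrite addrC subrK.
Qed.

Lemma sum_induced_density_adj W x (a b : 'I_k) : (a < b)%N ->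
  \sum_(F : graph k | adj F a b) induced_density F W x = W (x a, x b).
Proof.
move=> ab; pose E := [set a; b]%SET.
have E2 : #|E| == 2%N by rewrite cards2 neq_ltn ab.
(* A zero non-edge weight at [E] kills the graphs without the edge [ab]. In the product over edges
   only the factor [W (x a, x b)] at [E] differs from 1. *)
pose v e := if e == E then 0 else 1 - edge_weight W x e.
transitivity (\prod_(e : {set 'I_k} | #|e| == 2%N) (edge_weight W x e + v e)).
  rewrite -sum_graph_prod big_mkcond; apply: eq_bigr => F _.
  rewrite induced_densityE; case: ifPn => abF.
    apply: eq_bigr => e _; rewrite /v; case: ifP => // /negbT eF.
    by rewrite ifN//; apply: contraNneq eF => ->.
  have /negbTE EF : E \notin val F by [].
    by rewrite (bigD1 E)//= EF /v eqxx mul0r.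
rewrite (bigD1 E)//= /v eqxx addr0 edge_weightE// big1 ?mulr1//.
by move=> e /andP[_ /negbTE ->]; rewrite addrC subrK.
Qed.

Lemma edge_weight_bound W x (e : {set 'I_k}) (B : R) : 1 <= B ->
  (forall z, `|W z| <= B /\ `|1 - W z| <= B) ->
  `|edge_weight W x e| <= B /\ `|1 - edge_weight W x e| <= B.
Proof.
move=> B1 WB; rewrite /edge_weight; case: pickP => // _.
by rewrite subr0 normr0 normr1; lra.
Qed.

Lemma induced_density_dist (F : graph k) U W x (B e : R) : 1 <= B -> 0 <= e ->
  (forall z, `|U z| <= B /\ `|1 - U z| <= B) ->
  (forall z, `|W z| <= B /\ `|1 - W z| <= B) ->
  (forall z, `|U z - W z| <= e) ->
  `|induced_density F U x - induced_density F W x|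
    <= B ^+ 'C(k, 2) * ('C(k, 2)%:R * e).
Proof.
move=> B1 e0 UB WB UW; rewrite !induced_densityE -card_2sets.
apply: prod_dist => // E.
- by have [] := edge_weight_bound x E B1 UB; case: ifP.
- by have [] := edge_weight_bound x E B1 WB; case: ifP.
have : `|edge_weight U x E - edge_weight W x E| <= e.
  by rewrite /edge_weight; case: pickP => // _; rewrite subrr normr0.
case: ifP => // _; rewrite distrC => h.
by have -> : forall p q : R, 1 - p - (1 - q) = q - p by move=> p q; ring.
Qed.

End graph_sums.

(** * Sign, size and Lipschitz bounds for the velocity *)

Section velocity_theory.
Context d (T : measurableType d) (R : realType) (P : probability T R) (k : nat)
  (r : graph k -> graph k -> R).
Implicit Types (U W : T * T -> R) (F H : graph k) (a b : 'I_k).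

Lemma adjC F a b : adj F a b = adj F b a.
Proof. by rewrite /adj finset.setUC. Qed.

Lemma rooted_densityC F a b W z : a != b ->
  rooted_density P F a b W (z.2, z.1) = rooted_density P F b a W z.
Proof.
move=> ab; rewrite /rooted_density finset.setUC; apply: multi_integral_local => i.
rewrite mem_enum !inE negbK => /orP[]/eqP -> /=; rewrite ?eqxx.
  by rewrite eq_sym (negbTE ab).
by rewrite (negbTE ab).
Qed.

(** Swapping the roots exchanges the ordered pairs [(a, b)] and [(b, a)], both of which are summed.
    This needs no symmetry of [W], so Euler steps preserve symmetry at every point. *)
Lemma velocityC W z : velocity P r W (z.2, z.1) = velocity P r W z.
Proof.
apply: eq_bigr => F _; apply: eq_bigr => H _; congr (_ * _).
rewrite (exchange_big_dep predT)//=; apply: eq_bigr => b _.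
apply: eq_big => [a|a ab]; first by rewrite eq_sym.
by rewrite rooted_densityC// (adjC H) (adjC F).
Qed.

Context (hr : is_rule r).

Lemma is_rule_ge0 F H : 0 <= r F H. Proof. by have [/(_ F H)/andP[]] := hr. Qed.

Lemma is_rule_sum F : \sum_H r F H = 1. Proof. by have [_ ->] := hr. Qed.

Lemma is_rule_mean F (c : R) : c = \sum_H r F H * c.
Proof. by rewrite -mulr_suml is_rule_sum mul1r. Qed.

(** The constant counts the graphs [F] and the ordered pairs [(a, b)], times the variation of one
    induced density. The sum over [H] costs nothing because the rows of [r] have sum 1. *)
Lemma velocity_dist U W (B e : R) : 1 <= B -> 0 <= e ->
  measurable_fun setT U -> measurable_fun setT W ->
  (forall z, `|U z| <= B /\ `|1 - U z| <= B) ->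
  (forall z, `|W z| <= B /\ `|1 - W z| <= B) ->
  (forall z, `|U z - W z| <= e) ->
  forall z, `|velocity P r U z - velocity P r W z|
    <= 2 ^+ 'C(k, 2) * ((k ^_ 2)%:R * (B ^+ 'C(k, 2) * ('C(k, 2)%:R * e))).
Proof.
move=> B1 e0 mU mW UB WB UW z; set D := B ^+ _ * _.
have D0 : 0 <= D.
  by rewrite /D !mulr_ge0// exprn_ge0//; lra.
have hT F a b : `|rooted_density P F a b U z - rooted_density P F a b W z| <= D.
  apply: multi_integral_dist.
  - exact: tame_induced_density mU (fun z => (UB z).1).
  - exact: tame_induced_density mW (fun z => (WB z).1).
  - by move=> x; exact: induced_density_dist.
rewrite -card_graph -sumrB; apply: (le_trans (ler_norm_sum _ _ _)).
rewrite mulr_natl -sumr_const; apply: ler_sum => F _.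
rewrite [leRHS](is_rule_mean F) -sumrB.
apply: (le_trans (ler_norm_sum _ _ _)); apply: ler_sum => H _.
rewrite -mulrBr normrM (ger0_norm (is_rule_ge0 F H)).
apply: ler_wpM2l; first exact: is_rule_ge0.
rewrite -sum_neq_pairs -sumrB; apply: (le_trans (ler_norm_sum _ _ _)).
apply: ler_sum => a _; rewrite -sumrB; apply: (le_trans (ler_norm_sum _ _ _)).
apply: ler_sum => b _; rewrite -mulrBl normrM -[leRHS]mulr1.
apply: ler_pM => //.
by case: (adj H a b); case: (adj F a b); rewrite /= ?subrr ?subr0 ?sub0r ?normrN ?normr0 ?normr1.
Qed.

(** The conditions hold at every point, so that the Euler estimates can be made pointwise, with no
    null sets to track along the iteration. *)
Definition sym_graphon W := [/\ measurable_fun setT W,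
  forall z, 0 <= W z <= 1 & forall z, W (z.2, z.1) = W z].

Lemma sym_graphon_unit W z : sym_graphon W -> `|W z| <= 1 /\ `|1 - W z| <= 1.
Proof. by move=> [_ /(_ z) W01 _]; rewrite !ler_norml; lra. Qed.

Lemma rooted_density_ge0 F a b W z : sym_graphon W -> 0 <= rooted_density P F a b W z.
Proof.
move=> gW; have [mW W01 _] := gW.
have := @le_multi_integral _ _ _ P k (enum (~: [set a; b])%SET) (fun=> 0)
  (induced_density F W) (tame_cst T k 0)
  (tame_induced_density F mW (fun z => (sym_graphon_unit z gW).1)).
rewrite /rooted_density => /(_ _ [eta (fun=> z.1) with b |-> z.2]).
rewrite multi_integral_cst//; apply => x.
apply: prodr_ge0 => i _; apply: prodr_ge0 => j _.
by have := W01 (x i, x j); case: ifP => _; lra.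
Qed.

Lemma sum_rooted_density W a b z : sym_graphon W ->
  \sum_(F : graph k) rooted_density P F a b W z = 1.
Proof.
move=> gW; have [mW _ _] := gW; rewrite /rooted_density -multi_integral_sum.
  under [X in multi_integral P _ X]eq_fun do rewrite sum_induced_density.
  by rewrite multi_integral_cst.
by move=> F; exact: tame_induced_density mW (fun z => (sym_graphon_unit z gW).1).
Qed.

(** The integrands add up to [W (x a, x b)], which does not depend on the integrated coordinates.
    For [b < a] the symmetry of [W] is used. *)
Lemma sum_rooted_density_adj W a b z : sym_graphon W -> a != b ->
  \sum_(F : graph k | adj F a b) rooted_density P F a b W z = W z.
Proof.
move=> gW ab; have [mW _ sW] := gW; rewrite /rooted_density -multi_integral_sum; last first.
  by move=> F; exact: tame_induced_density mW (fun z => (sym_graphon_unit z gW).1).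
have -> : (fun x => \sum_(F : graph k | adj F a b) induced_density F W x) =
    fun x => W (x a, x b).
  apply/funext => x; have := ab; rewrite neq_ltn => /orP[ltab|ltba].
    exact: sum_induced_density_adj.
  under eq_bigl do rewrite adjC.
  by rewrite sum_induced_density_adj// -[RHS]sW.
rewrite multi_integral_cst /=.
  by rewrite eqxx (negbTE ab) -surjective_pairing.
move=> y i t; rewrite mem_enum !inE negb_or => /andP[ia ib] /=.
by rewrite ![_ == i]eq_sym (negbTE ia) (negbTE ib).
Qed.

Lemma velocityE W z : velocity P r W z =
  \sum_(a < k) \sum_(b < k | a != b) \sum_F \sum_H r F H *
     (rooted_density P F a b W z *
      ((adj H a b && ~~ adj F a b)%:R - (adj F a b && ~~ adj H a b)%:R)).
Proof.
rewrite /velocity.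
under eq_bigr => F _ do under eq_bigr => H _ do rewrite mulr_sumr.
under eq_bigr => F _ do rewrite exchange_big /=.
rewrite exchange_big /=; apply: eq_bigr => a _.
under eq_bigr => F _ do under eq_bigr => H _ do rewrite mulr_sumr.
under eq_bigr => F _ do rewrite exchange_big /=.
by rewrite exchange_big.
Qed.

(** For a fixed pair [(a, b)] only graphs [F] containing [ab] can lose that edge, and their rooted
    densities add up to [W z]. *)
Lemma velocity_ge W z : sym_graphon W -> - ((k ^_ 2)%:R * W z) <= velocity P r W z.
Proof.
move=> gW; rewrite velocityE -mulrN -sum_neq_pairs.
apply: ler_sum => a _; apply: ler_sum => b ab.
rewrite -[W z](sum_rooted_density_adj z gW ab) -sumrN big_mkcond /=.
apply: ler_sum => F _; rewrite [leLHS](is_rule_mean F).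
apply: ler_sum => H _; apply: ler_wpM2l; first exact: is_rule_ge0.
have := rooted_density_ge0 F a b z gW.
by case: (adj H a b); case: (adj F a b) => /=; lra.
Qed.

(** Only graphs [F] without [ab] can gain that edge, and their rooted densities add up to
    [1 - W z]. *)
Lemma velocity_le W z : sym_graphon W -> velocity P r W z <= (k ^_ 2)%:R * (1 - W z).
Proof.
move=> gW; rewrite velocityE -sum_neq_pairs.
apply: ler_sum => a _; apply: ler_sum => b ab.
have -> : 1 - W z = \sum_(F : graph k) (rooted_density P F a b W z -
    (if adj F a b then rooted_density P F a b W z else 0)).
  by rewrite sumrB sum_rooted_density// -big_mkcond sum_rooted_density_adj.
apply: ler_sum => F _; rewrite [leRHS](is_rule_mean F).
apply: ler_sum => H _; apply: ler_wpM2l; first exact: is_rule_ge0.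
have := rooted_density_ge0 F a b z gW.
by case: (adj H a b); case: (adj F a b) => /=; lra.
Qed.

Lemma velocity_norm_le W z : sym_graphon W -> `|velocity P r W z| <= (k ^_ 2)%:R.
Proof.
move=> gW; have [_ /(_ z)/andP[W0 W1] _] := gW.
have := velocity_ge z gW; have := velocity_le z gW.
have K0 : 0 <= (k ^_ 2)%:R :> R by exact: ler0n.
have := mulr_ge0 K0 W0.
have : 0 <= (k ^_ 2)%:R * (1 - W z) by rewrite mulr_ge0//; lra.
by rewrite ler_norml; lra.
Qed.

Lemma velocity_bounded W (B : R) : measurable_fun setT W ->
  (forall z, `|W z| <= B) -> exists2 C, 0 <= C & forall z, `|velocity P r W z| <= C.
Proof.
move=> mW WB; have K0 : 0 <= (k ^_ 2)%:R :> R by exact: ler0n.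
have B0 (z : T * T) : 0 <= B by exact: le_trans (normr_ge0 _) (WB z).
have g0 : sym_graphon (cst 0) by split => // z; rewrite lexx ler01.
(* The bound compares [W] with the zero graphon. It is stated with [|B|], as [0 <= B] is derived
   only once a point is given. *)
exists ((k ^_ 2)%:R + 2 ^+ 'C(k, 2) *
   ((k ^_ 2)%:R * ((1 + `|B|) ^+ 'C(k, 2) * ('C(k, 2)%:R * `|B|)))).
  by rewrite addr_ge0// !mulr_ge0// exprn_ge0// addr_ge0.
move=> z; have B0z := B0 z; clear B0.
have -> : velocity P r W z = velocity P r (cst 0) z +
  (velocity P r W z - velocity P r (cst 0) z) by ring.
apply: (le_trans (ler_normD _ _)); apply: lerD; first exact: velocity_norm_le.
apply: velocity_dist => //; rewrite ?(ger0_norm B0z).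
- by lra.
- by move=> y; have := WB y; rewrite !ler_norml; lra.
- by move=> y /=; rewrite subr0 normr0 normr1; lra.
- by move=> y /=; rewrite subr0.
Qed.

(** By [velocity_ge] and [velocity_le] the new value lies between [(1 - h (k)_2) W] and
    [W + h (k)_2 (1 - W)], hence in [0, 1]. *)
Lemma sym_graphon_step W (h : R) : sym_graphon W -> 0 <= h -> h * (k ^_ 2)%:R <= 1 ->
  sym_graphon (euler_step (velocity P r) h W).
Proof.
move=> gW h0 hK; have [mW W01 sW] := gW; split.
- apply: measurable_funD => //; apply: measurable_funM; first exact: measurable_cst.
  exact: measurable_velocity mW (fun z => (sym_graphon_unit z gW).1).
- move=> z; have /andP[W0 W1] := W01 z; rewrite /euler_step.
  have h1 := ler_wpM2l h0 (velocity_ge z gW).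
  have h2 := ler_wpM2l h0 (velocity_le z gW).
  have h3 := ler_wpM2r W0 hK.
  have W1' : 0 <= 1 - W z by lra.
  have h4 := ler_wpM2r W1' hK.
  by lra.
- by move=> z; rewrite /euler_step velocityC sW.
Qed.

Lemma sym_graphon_cvg (f : nat -> T * T -> R) W : (forall n, sym_graphon (f n)) ->
  (forall z, f ^~ z @ \oo --> W z) -> sym_graphon W.
Proof.
move=> gf fW; split.
- by apply: (measurable_fun_cvg (h := f)) => // n; have [] := gf n.
- move=> z; apply/andP; split.
    apply: (@ler_cvg_to _ \oo _ R (cst 0) (f ^~ z)); [exact: cvg_cst|exact: fW|].
    by apply: nearW => n; have [_ /(_ z)/andP[]] := gf n.
  apply: (@ler_cvg_to _ \oo _ R (f ^~ z) (cst 1)); [exact: fW|exact: cvg_cst|].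
  by apply: nearW => n; have [_ /(_ z)/andP[]] := gf n.
- move=> z; apply: cvg_unique (fW (z.2, z.1)) _ => //.
  have -> : f ^~ (z.2, z.1) = f ^~ z; last exact: fW.
  by apply/funext => n; have [_ _ ->] := gf n.
Qed.

(** This is the constant [C_k]; the exponent is an integer because it equals -1 when [k < 2]. *)
Definition velocity_lip : R := (k ^_ 2)%:R ^+ 2 * 2 ^ ('C(k, 2)%:Z - 1).

Lemma velocity_lipE : velocity_lip =
  2 ^+ 'C(k, 2) * ((k ^_ 2)%:R * 'C(k, 2)%:R).
Proof.
rewrite /velocity_lip expfzDr// -exprnP -bin_ffact natrM.
by rewrite (_ : 2 ^ (- 1) = 2^-1 :> R)// (_ : 2`! = 2)%N//; field.
Qed.

Lemma velocity_sym_graphon_lip U W (e : R) : sym_graphon U -> sym_graphon W ->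
  (forall z, `|U z - W z| <= e) ->
  forall z, `|velocity P r U z - velocity P r W z| <= velocity_lip * e.
Proof.
move=> gU gW UW z; have [mU _ _] := gU; have [mW _ _] := gW.
have e0 : 0 <= e by exact: le_trans (normr_ge0 _) (UW z).
rewrite velocity_lipE -!mulrA -[X in _ * (_ * X)]mul1r -[X in X * (_%:R * e)](expr1n R 'C(k, 2)).
by apply: velocity_dist => // y; exact: sym_graphon_unit.
Qed.

Theorem sym_graphon_flow W : sym_graphon W -> exists u : R -> T * T -> R,
  [/\ u 0 = W, forall t : R, 0 <= t -> sym_graphon (u t),
      forall t h : R, 0 <= t -> 0 <= h ->
        forall z, `|u (t + h) z - u t z| <= (k ^_ 2)%:R * h &
      forall t h : R, 0 <= t -> 0 <= h -> forall z,
        `|u (t + h) z - u t z - h * velocity P r (u t) z|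
          <= velocity_lip * (k ^_ 2)%:R * h ^+ 2].
Proof.
apply: euler_flow.
- exact: ler0n.
- by rewrite velocity_lipE !mulr_ge0.
- exact: sym_graphon_step.
- by move=> ? ? ?; exact: velocity_norm_le.
- exact: velocity_sym_graphon_lip.
- exact: sym_graphon_cvg.
Qed.

End velocity_theory.

(** * Solutions and the flow of graphons *)

Section Linfty_theory.
Context d (T : measurableType d) (R : realType) (P : probability T R).
Implicit Types (f : T * T -> R).

(** The definition of the norm distinguishes whether the total mass is positive; here it is 1. *)
Lemma Linfty_normE f : Linfty_norm P f = ess_sup (P \x P)%E (fun z => `|f z|%:E).
Proof.
have PT : (P \x P)%E setT = 1%E.
  rewrite -setXTT product_measure1E//.
  by rewrite [X in (X * _)%E]probability_setT [X in (_ * X)%E]probability_setT mule1.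
by rewrite /Linfty_norm unlock [X in (0 < X)%E]PT lte01.
Qed.

Lemma Linfty_normP f (c : R) :
  (Linfty_norm P f <= c%:E)%E <-> {ae (P \x P)%E, forall z, `|f z| <= c}.
Proof.
rewrite Linfty_normE; split=> [/ess_supP|h]; first by apply: filterS => z; rewrite lee_fin.
by apply/ess_supP; apply: filterS h => z; rewrite lee_fin.
Qed.

Lemma Linfty_norm_ge0 f : (0 <= Linfty_norm P f)%E.
Proof. exact: Lnorm_ge0. Qed.

Lemma Linfty_norm_fin f (c : R) : {ae (P \x P)%E, forall z, `|f z| <= c} ->
  Linfty_norm P f \is a fin_num.
Proof.
move=> /Linfty_normP h; rewrite ge0_fin_numE ?Linfty_norm_ge0//.
by apply: (le_lt_trans h); rewrite ltry.
Qed.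

Lemma Linfty_cvg0P (g : R -> T * T -> R) :
  (Linfty_norm P (g h) @[h --> 0^'] --> 0%E) <->
  forall eps : R, 0 < eps -> \forall h \near 0^',
    {ae (P \x P)%E, forall z, `|g h z| <= eps}.
Proof.
split.
  move=> /fine_cvgP[gfin /cvgrPdist_le gcvg] eps /gcvg geps.
  apply: filterS2 gfin geps => h hfin /=; rewrite sub0r normrN => heps.
  apply/Linfty_normP; rewrite -(fineK hfin) lee_fin.
  exact: le_trans (ler_norm _) heps.
move=> hg; apply/fine_cvgP; split.
  by apply: filterS (hg 1 ltr01) => h; exact: Linfty_norm_fin.
apply/cvgrPdist_le => eps eps0; apply: filterS (hg _ eps0) => h gh /=.
rewrite sub0r normrN ger0_norm ?fine_ge0 ?Linfty_norm_ge0//.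
rewrite -lee_fin fineK; last exact: Linfty_norm_fin gh.
exact/Linfty_normP.
Qed.

Lemma diff_quotient_le (a v h eps : R) : h != 0 ->
  (`|a / h - v| <= eps) = (`|a - h * v| <= `|h| * eps).
Proof.
move=> h0; have -> : a - h * v = h * (a / h - v) by field.
by rewrite normrM ler_pM2l// normr_gt0.
Qed.

Definition Linfty_derivative (Phi : R -> T * T -> R) (V : T * T -> R) (t : R) :=
  forall eps : R, 0 < eps -> exists2 del, 0 < del & forall h : R, h != 0 -> `|h| < del ->
    {ae (P \x P)%E, forall z, `|Phi (t + h) z - Phi t z - h * V z| <= `|h| * eps}.

Lemma Linfty_derivativeP (Phi : R -> T * T -> R) (V : T * T -> R) (t : R) :
  (Linfty_norm P (fun z => (Phi (t + h) z - Phi t z) / h - V z)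
     @[h --> 0^'] --> 0%E) <-> Linfty_derivative Phi V t.
Proof.
split.
  move=> /(Linfty_cvg0P (fun h z => (Phi (t + h) z - Phi t z) / h - V z)) hc eps eps0.
  have /near_dnbhs0P[del del0 hd] := hc _ eps0.
  exists del => // h h0 hdel; apply: filterS (hd h h0 hdel) => z.
  by rewrite diff_quotient_le.
move=> hc; apply/(Linfty_cvg0P (fun h z => (Phi (t + h) z - Phi t z) / h - V z)).
move=> eps eps0; have [del del0 hd] := hc _ eps0.
apply/near_dnbhs0P; exists del => // h h0 hdel.
by apply: filterS (hd h h0 hdel) => z; rewrite diff_quotient_le.
Qed.

Lemma sym_graphon_repr (W : T * T -> R) : is_graphon P W ->
  exists2 W0, sym_graphon W0 & {ae (P \x P)%E, forall z, W z = W0 z}.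
Proof.
move=> [[mW _ sW] W01].
(* Averaging with the transpose and clamping to [0, 1] change a graphon only on a null set. *)
pose W0 (z : T * T) := Num.max 0 (Num.min 1 ((W z + W (z.2, z.1)) / 2)).
exists W0; first split.
- apply: (@measurable_maxr _ _ _ _ (cst 0)
    (fun z => Num.min 1 ((W z + W (z.2, z.1)) / 2))); first exact: measurable_cst.
  apply: (@measurable_minr _ _ _ _ (cst 1) (fun z => (W z + W (z.2, z.1)) / 2)).
    exact: measurable_cst.
  apply: measurable_funM; last exact: measurable_cst.
  by apply: measurable_funD => //; apply: (measurableT_comp mW); exact: measurable_swap.
- move=> z; rewrite /W0 le_max lexx /= ge_max ler01 /= ge_min lexx //.
- by move=> z; rewrite /W0/= addrC -surjective_pairing.
- apply: filterS2 sW W01 => z sz /andP[z0 z1]; rewrite /W0 -sz.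
  have -> : (W z + W z) / 2 = W z by field.
  by rewrite min_r// max_r.
Qed.

Lemma sym_graphon_is_graphon (W : T * T -> R) : sym_graphon W -> is_graphon P W.
Proof.
move=> gW; have [mW W01 sW] := gW; split; last exact: aeW.
split=> //; last by apply: aeW => z; rewrite sW.
by exists 1 => z; exact: (sym_graphon_unit z gW).1.
Qed.

End Linfty_theory.

(** * Comparison of solutions with flows of graphons *)

Section solutions.
Context d (T : measurableType d) (R : realType) (P : probability T R) (k : nat)
  (r : graph k -> graph k -> R) (hr : is_rule r).
Implicit Types (U W : T * T -> R).
Local Notation K := ((k ^_ 2)%:R : R).
Local Notation L := (velocity_lip R k).

Let K0 : 0 <= K. Proof. exact: ler0n. Qed.

Let L0 : 0 <= L. Proof. by rewrite velocity_lipE !mulr_ge0. Qed.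

Lemma kernel_velocity_ae U W : is_kernel P U -> is_kernel P W ->
  {ae (P \x P)%E, forall z, U z = W z} ->
  {ae (P \x P)%E, forall z, velocity P r U z = velocity P r W z}.
Proof. by move=> [mU [B UB] _] [mW [C WC] _]; exact: velocity_ae UB WC. Qed.

(* Replacing [U] by its truncation to [[W - e, W + e]] makes the hypothesis hold
   everywhere without changing [velocity P r U] almost everywhere. *)
Lemma velocity_ae_dist U W (e : R) : is_kernel P U -> sym_graphon W ->
  0 <= e <= 1 -> {ae (P \x P)%E, forall z, `|U z - W z| <= e} ->
  {ae (P \x P)%E, forall z, `|velocity P r U z - velocity P r W z| <=
    2 ^+ 'C(k, 2) * (K * (2 ^+ 'C(k, 2) * 'C(k, 2)%:R)) * e}.
Proof.
move=> [mU [B UB] _] gW /andP[e0 e1] UW; have [mW W01 _] := gW.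
pose U' z := Num.max (W z - e) (Num.min (U z) (W z + e)).
have U'W z : W z - e <= U' z <= W z + e.
  by rewrite /U' le_max lexx /= ge_max ge_min lexx orbT andbT; lra.
have mU' : measurable_fun setT U'.
  apply: (@measurable_maxr _ _ _ _ (fun z => W z - e)
    (fun z => Num.min (U z) (W z + e))); first exact: measurable_funB.
  by apply: (@measurable_minr _ _ _ _ U (fun z => W z + e)) => //; exact: measurable_funD.
(* Since [e <= 1], the values of [U'] lie in [-1, 2]; hence the base 2 for [velocity_dist], which
   gives the second power of 2 in the constant. *)
have U'B z : `|U' z| <= 2 /\ `|1 - U' z| <= 2.
  by have := U'W z; have := W01 z; rewrite !ler_norml; lra.
have UU' : {ae (P \x P)%E, forall z, U z = U' z}.
  apply: filterS UW => z; rewrite ler_norml => hz; rewrite /U'.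
  by rewrite min_l ?max_r//; lra.
apply: filterS (velocity_ae r mU mU' UB (fun z => (U'B z).1) UU') => z ->.
rewrite -!mulrA; apply: velocity_dist => //; first by lra.
- move=> y; have [h1 h2] := sym_graphon_unit y gW; lra.
- by move=> y; have := U'W y; rewrite ler_norml; lra.
Qed.

Definition is_flow (u : R -> T * T -> R) :=
  [/\ forall t : R, 0 <= t -> sym_graphon (u t),
      forall t h : R, 0 <= t -> 0 <= h -> forall z, `|u (t + h) z - u t z| <= K * h &
      forall t h : R, 0 <= t -> 0 <= h -> forall z,
        `|u (t + h) z - u t z - h * velocity P r (u t) z| <= L * K * h ^+ 2].

Lemma flow_dist u s t : is_flow u -> 0 <= s -> 0 <= t ->
  forall z, `|u t z - u s z| <= K * `|t - s|.
Proof.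
move=> [_ hu _] s0 t0 z; have [st|ts] := leP s t.
  have ts0 : 0 <= t - s by lra.
  by rewrite (ger0_norm ts0); have := hu s (t - s) s0 ts0 z; rewrite subrKC.
have st0 : 0 <= s - t by lra.
rewrite distrC [X in K * X]distrC (ger0_norm st0).
by have := hu t (s - t) t0 st0 z; rewrite subrKC.
Qed.

(** For negative [h] the forward bound is applied from [t + h], and the velocity there is then
    replaced by the one at [t]. The Lipschitz error of this replacement accounts for the factor
    2. *)
Lemma flow_taylor u t h : is_flow u -> 0 <= t -> 0 <= t + h ->
  forall z, `|u (t + h) z - u t z - h * velocity P r (u t) z| <= 2 * (L * K) * h ^+ 2.
Proof.
move=> fu t0 th0 z; have [gu hu tu] := fu.
have LK0 : 0 <= L * K by exact: mulr_ge0.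
have LKh0 : 0 <= L * K * h ^+ 2 by rewrite mulr_ge0// sqr_ge0.
have [h0|h0] := leP 0 h; first by have := tu t h t0 h0 z; lra.
have mh0 : 0 <= - h by lra.
have e1 := tu (t + h) (- h) th0 mh0 z; rewrite addrK in e1.
have e2 := velocity_sym_graphon_lip P hr (gu _ th0) (gu _ t0)
  (flow_dist fu t0 th0) z.
rewrite addrAC subrr add0r (ltr0_norm h0) in e2.
set v := velocity P r (u (t + h)) z in e1 e2; set w := velocity P r (u t) z in e2 *.
have -> : u (t + h) z - u t z - h * w =
  - (u t z - u (t + h) z - - h * v) - (- h) * (v - w) by ring.
apply: (le_trans (ler_normB _ _)); rewrite normrN normrM (ger0_norm mh0).
have := ler_wpM2l mh0 e2; rewrite sqrrN in e1; lra.
Qed.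

Lemma flow_Linfty_derivative u t : is_flow u -> 0 < t ->
  Linfty_derivative P u (velocity P r (u t)) t.
Proof.
move=> fu t0 eps eps0; have LK0 : 0 <= L * K by exact: mulr_ge0.
pose c := 2 * (L * K) + 1; have c0 : 0 < c by rewrite /c; lra.
exists (Num.min t (eps / c)); first by rewrite lt_min t0 divr_gt0.
move=> h h0; rewrite lt_min => /andP[ht hc]; apply: aeW => z.
have th0 : 0 <= t + h by move: ht; rewrite ltr_norml; lra.
apply: (le_trans (flow_taylor fu (ltW t0) th0 z)).
have -> : h ^+ 2 = `|h| * `|h| by rewrite -normrM -expr2 ger0_norm ?sqr_ge0.
rewrite mulrCA; apply: ler_wpM2l => //.
by move: hc; rewrite ltr_pdivlMr// /c; have := normr_ge0 h; lra.
Qed.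

(** * Uniqueness forward from a time at which the solution is a graphon *)

Section uniqueness.
Context (W : T * T -> R) (D : set R) (Phi : R -> T * T -> R)
  (sol : is_solution P r W D Phi) (u : R -> T * T -> R) (fu : is_flow u)
  (t0 : R) (Dt0 : D t0) (Phi0 : {ae (P \x P)%E, forall z, Phi t0 z = u 0 z}).

Let e (s : R) : R := fine (Linfty_norm P (fun z => Phi (t0 + s) z - u s z)).

Let e_ge0 s : 0 <= e s.
Proof. by rewrite fine_ge0// Linfty_norm_ge0. Qed.

Let e_le s c : {ae (P \x P)%E, forall z, `|Phi (t0 + s) z - u s z| <= c} -> e s <= c.
Proof.
move=> h; rewrite -lee_fin /e fineK; last exact: Linfty_norm_fin h.
exact/Linfty_normP.
Qed.

Let e_ae s : 0 <= s -> D (t0 + s) ->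
  {ae (P \x P)%E, forall z, `|Phi (t0 + s) z - u s z| <= e s}.
Proof.
move=> s0 Ds; apply/Linfty_normP; rewrite /e fineK//.
have [_ /(_ _ Ds)[_ [B hB] _] _ _] := sol; have [gu _ _] := fu.
apply: (@Linfty_norm_fin _ _ _ _ _ (B + 1)); apply: aeW => z.
apply: (le_trans (ler_normB _ _)); apply: lerD => //.
exact: (sym_graphon_unit z (gu _ s0)).1.
Qed.

(** Gronwall's lemma is applied to the distance [e]. After [t0] the solution is only known to be a
    kernel, so the Lipschitz bound in use is [velocity_ae_dist], valid within distance 1 of the
    flow; this is why [gronwall_eq0] asks for growth control only where [e s <= 1]. *)
Lemma solution_eq_flow s : 0 <= s -> D (t0 + s) ->
  {ae (P \x P)%E, forall z, Phi (t0 + s) z = u s z}.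
Proof.
move=> s0 Ds; have [[oD iD _] kPhi _ dPhi] := sol; have [gu hu tu] := fu.
have Dx x : 0 <= x -> x <= s -> D (t0 + x).
  by move=> x0 xs; apply: (iD t0 (t0 + s)) => //; lra.
suff es : e s = 0.
  by apply: filterS (e_ae s0 Ds) => z; rewrite es normr_le0 subr_eq0 => /eqP.
pose L2 : R := 2 ^+ 'C(k, 2) * (K * (2 ^+ 'C(k, 2) * 'C(k, 2)%:R)).
have LK0 : 0 <= L * K by exact: mulr_ge0.
apply: (@gronwall_eq0 R e L2 s) => //.
- by rewrite /L2 !mulr_ge0.
- apply/eqP; rewrite eq_le e_ge0 andbT; apply: e_le; rewrite addr0.
  by apply: filterS Phi0 => z ->; rewrite subrr normr0.
- move=> x x0 xs; have Dx' := Dx x (ltW x0) xs.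
  have [mPhi [B PhiB] _] := kPhi _ Dx'.
  have [C C0 hC] := velocity_bounded P hr mPhi PhiB.
  (* The summands bound the differentiation error at precision 1, the velocity of [Phi (t0 + x)] and
     the Lipschitz constant of the flow. *)
  exists (1 + C + K); first by rewrite !addr_ge0.
  have [d1 d10 hd1] := (Linfty_derivativeP P Phi _ _).1 (dPhi _ Dx') 1 ltr01.
  have /nbhs_ballP[d2 d20 hd2] : nbhs (t0 + x) D by exact: open_nbhs_nbhs.
  apply/near_dnbhs0P; exists (Num.min d1 (Num.min d2 x)).
    by rewrite !lt_min d10 d20 x0.
  move=> h h0; rewrite !lt_min => /and3P[h1 h2 h3].
  have xh0 : 0 <= x + h by move: h3; rewrite ltr_norml; lra.
  have Dxh : D (t0 + (x + h)).
    apply: hd2; rewrite /ball /= addrA opprD addNKr normrN//.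
  apply: e_le; apply: filterS2 (e_ae xh0 Dxh) (hd1 h h0 h1) => z.
  rewrite -(addrA t0 x h).
  have := flow_dist fu xh0 (ltW x0) z; have := hC z.
  have -> : x - (x + h) = - h by ring.
  rewrite normrN mulr1.
  set p := Phi (t0 + x) z; set p' := Phi (t0 + (x + h)) z; set q := u x z.
  set q' := u (x + h) z; set v := velocity _ _ _ _ => a1 a2 a3 a4.
  have -> : p - q = (p' - q') - (p' - p - h * v) - h * v - (q - q') by ring.
  apply: (le_trans (ler_normB _ _)).
  apply: (@le_trans _ _ (e (x + h) + `|h| + `|h| * C + K * `|h|)); last by lra.
  apply: lerD => //; apply: (le_trans (ler_normB _ _)); apply: lerD.
    by apply: (le_trans (ler_normB _ _)); exact: lerD.
  by rewrite normrM; apply: ler_wpM2l.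
- move=> x x0 xs ex1 eps eps0.
  have Dx' := Dx x x0 (ltW xs).
  (* One half of [eps] is for the differentiation error of [Phi], the other for the Taylor error
     [L * K * h ^+ 2] of the flow. *)
  have eps20 : 0 < eps / 2 by lra.
  have [d1 d10 hd1] := (Linfty_derivativeP P Phi _ _).1 (dPhi _ Dx') _ eps20.
  pose c := L * K + 1; have c0 : 0 < c by rewrite /c; lra.
  apply/near_right0P; exists (Num.min d1 (Num.min (s - x) (eps / 2 / c))).
    by rewrite !lt_min d10 divr_gt0// andbT /=; lra.
  move=> h h0; rewrite !lt_min => /and3P[h1 h2 h3].
  have h00 : h != 0 by rewrite gt_eqF.
  have hn : `|h| < d1 by rewrite gtr0_norm.
  have ev := velocity_ae_dist (kPhi _ Dx') (gu _ x0) _ (e_ae x0 Dx').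
  have {}ev := ev (introT andP (conj (e_ge0 x) ex1)).
  apply: e_le; apply: filterS3 (e_ae x0 Dx') (hd1 h h00 hn) ev => z.
  rewrite -(addrA t0 x h) -/L2 (gtr0_norm h0).
  have := tu x h x0 (ltW h0) z.
  set p := Phi (t0 + x) z; set p' := Phi (t0 + (x + h)) z; set q := u x z.
  set q' := u (x + h) z; set v := velocity _ _ (Phi _) _.
  set w := velocity _ _ (u _) _ => a1 a2 a3 a4.
  have -> : p' - q' = (p - q) + (p' - p - h * v) + h * (v - w) - (q' - q - h * w) by ring.
  have b1 : L * K * h ^+ 2 <= h * (eps / 2).
    have : h * c < eps / 2 by rewrite -ltr_pdivlMr.
    have hh : 0 <= h * h by rewrite mulr_ge0// ltW.
    by move=> /ltW/(ler_wpM2l (ltW h0)); rewrite /c expr2; lra.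
  apply: (@le_trans _ _ (e x + h * (eps / 2) + h * (L2 * e x) + L * K * h ^+ 2)).
    apply: (le_trans (ler_normB _ _)); apply: lerD => //.
    apply: (le_trans (ler_normD _ _)); apply: lerD.
      by apply: (le_trans (ler_normD _ _)); exact: lerD.
    by rewrite normrM (gtr0_norm h0); apply: ler_wpM2l => //; exact: ltW.
  by lra.
Qed.

End uniqueness.

Lemma graphon_flow W : is_graphon P W -> exists2 u, is_flow u &
  {ae (P \x P)%E, forall z, W z = u 0 z}.
Proof.
move=> /sym_graphon_repr[W0 gW0 WW0].
have [u [u0 gu hu tu]] := sym_graphon_flow P hr gW0.
by exists u; [split|rewrite u0].
Qed.

(* If [D] missed some positive time, gluing the flow of [W] to [Phi] at [0] would
   extend [Phi]. *)
Lemma maximal_solution_global W D Phi : is_graphon P W ->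
  is_maximal_solution P r W D Phi -> forall t, 0 <= t -> D t.
Proof.
move=> gW [sol maxD] t t0.
have [u fu Wu] := graphon_flow gW; have [gu hu tu] := fu.
have [[oD iD D0] kPhi Phi0 dPhi] := sol.
have Phiu : {ae (P \x P)%E, forall z, Phi 0 z = u 0 z}.
  by apply: filterS2 Phi0 Wu => z -> ->.
have kgu s : 0 <= s -> is_kernel P (u s).
  by move=> s0; have [] := sym_graphon_is_graphon P (gu _ s0).
pose D' := D `|` [set s | 0 < s].
pose Psi s := if s < 0 then Phi s else u s.
have PsiN s : s < 0 -> Psi s = Phi s by rewrite /Psi => ->.
have PsiP s : 0 <= s -> Psi s = u s by rewrite /Psi leNgt => /negbTE ->.
suff <- : D' = D.
  by move: t0; rewrite le_eqVlt => /predU1P[<-|?]; [left|right].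
apply: (maxD _ Psi).
- split.
  + split; [by apply: openU => //; exact: open_gt| |by left].
    move=> x y hx hy z /andP[xz zy]; have [z0|z0] := ltP 0 z; first by right.
    left; apply: (iD x 0) => //; last by rewrite xz z0.
    by case: hx => //= x0; exfalso; lra.
  + move=> s Ds; have [s0|s0] := ltP s 0.
      by rewrite PsiN//; apply: kPhi; case: Ds => //= ?; exfalso; lra.
    by rewrite PsiP//; exact: kgu.
  + by rewrite PsiP//; apply: filterS Wu => z ->.
  + move=> s Ds; apply/Linfty_derivativeP.
    have [s0|s0|s0] := ltgtP s 0.
    * rewrite PsiN// => eps eps0.
      have {}Ds : D s by case: Ds => //= ?; exfalso; lra.
      have [d1 d10 hd1] := (Linfty_derivativeP P Phi _ _).1 (dPhi _ Ds) _ eps0.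
      (* The radius keeps [s + h] negative, so that only the branch [Phi] of [Psi] is seen. *)
      exists (Num.min d1 (- s)); first by rewrite lt_min d10; lra.
      move=> h h0; rewrite lt_min => /andP[h1 h2].
      rewrite !PsiN//; first exact: hd1.
      by move: h2; rewrite ltr_norml; lra.
    * rewrite PsiP ?(ltW s0)// => eps eps0.
      have [d1 d10 hd1] := flow_Linfty_derivative fu s0 eps0.
      exists (Num.min d1 s); first by rewrite lt_min d10.
      move=> h h0; rewrite lt_min => /andP[h1 h2].
      rewrite !PsiP ?(ltW s0)//; first exact: hd1.
      by move: h2; rewrite ltr_norml; lra.
    (* At the junction the left derivative comes from [Phi] and the right one from the Taylor bound
       of the flow. They agree because [Phi 0] and [u 0] have almost everywhere equal velocities. *)
    * rewrite {}s0 PsiP// => eps eps0.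
      have [d1 d10 hd1] := (Linfty_derivativeP P Phi _ _).1 (dPhi _ D0) _ eps0.
      have LK0 : 0 <= L * K by exact: mulr_ge0.
      pose c := L * K + 1; have c0 : 0 < c by rewrite /c; lra.
      exists (Num.min d1 (eps / c)); first by rewrite lt_min d10 divr_gt0.
      move=> h h0; rewrite lt_min => /andP[h1 h2]; rewrite add0r (PsiP 0)//.
      have [hn|hp] := ltP h 0.
        have eV := kernel_velocity_ae (kPhi _ D0) (kgu 0 (lexx 0)) Phiu.
        apply: filterS3 Phiu eV (hd1 h h0 h1) => z e1 e2.
        by rewrite add0r e1 e2 PsiN.
      rewrite PsiP//; apply: aeW => z.
      have := tu 0 h (lexx 0) hp z; rewrite add0r => /le_trans; apply.
      rewrite (ger0_norm hp) expr2 mulrA mulrC; apply: ler_wpM2l => //.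
      by move: h2; rewrite ger0_norm// ltr_pdivlMr// /c; lra.
- by move=> s; left.
(* On nonnegative times in [D] uniqueness identifies the flow with [Phi], so [Psi] really extends
   [Phi]. *)
- move=> s Ds; have [s0|s0] := ltP s 0; first by apply: aeW => z; rewrite PsiN.
  rewrite PsiP//.
  have := @solution_eq_flow W D Phi sol u fu 0 D0 Phiu s s0; rewrite add0r => /(_ Ds).
  by apply: filterS => z ->.
Qed.

End solutions.

(** * The increment and Taylor bounds for the solution *)

Theorem lemma4p15 (d : measure_display) (T : measurableType d) (R : realType)
    (P : probability T R)
    (hatomless : atomless P) (hseparable : separable_measure P)
    (k : nat) (r : graph k -> graph k -> R) (hr : is_rule r)
    (W : T * T -> R) (hW : is_graphon P W)
    (D : set R) (Phi : R -> T * T -> R)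
    (hPhi : is_maximal_solution P r W D Phi) :
  (forall t u : R, graphon_times P D Phi t -> graphon_times P D Phi u ->
    (Linfty_norm P (fun z => Phi t z - Phi u z)%R
       <= ((k ^_ 2)%:R * `|t - u|)%:E)%E) /\
  (forall delta : R, 0 < delta ->
    let C := ((k ^_ 2)%:R ^+ 2 * 2 ^ ('C(k, 2)%:Z - 1)) : R in
    (Linfty_norm P (fun z => (Phi delta z - W z) / delta - velocity P r W z)%R
       <= (C * (k ^_ 2)%:R * delta)%:E)%E).
Proof.
have [sol _] := hPhi; have [[_ _ D0] kPhi Phi0 _] := sol.
split.
  suff dist t u : u <= t -> graphon_times P D Phi t -> graphon_times P D Phi u ->
      {ae (P \x P)%E, forall z, `|Phi t z - Phi u z| <= (k ^_ 2)%:R * `|t - u|}.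
    move=> t u ht hu; apply/Linfty_normP; have [ut|/ltW tu] := leP u t.
      exact: dist.
    by apply: filterS (dist _ _ tu hu ht) => z; rewrite distrC [`|u - t|]distrC.
  move=> ut [Dt _] [Du gu].
  (* The flow starts at the earlier time [u], where [Phi u] is a graphon; this covers negative times
     as well. *)
  have [v fv Phiv] := graphon_flow hr gu.
  have tu0 : 0 <= t - u by rewrite subr_ge0.
  have := solution_eq_flow hr sol fv Du Phiv tu0; rewrite subrKC => /(_ Dt) Phit.
  apply: filterS2 Phiv Phit => z -> ->.
  by have := flow_dist fv (lexx 0) tu0 z; rewrite subr0.
move=> delta delta0; lazy zeta; have [u fu Wu] := graphon_flow hr hW.
have Phiu : {ae (P \x P)%E, forall z, Phi 0 z = u 0 z}.
  by apply: filterS2 Phi0 Wu => z -> ->.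
have Dd := maximal_solution_global hr hW hPhi (ltW delta0).
have := solution_eq_flow hr sol fu D0 Phiu (ltW delta0); rewrite add0r => /(_ Dd) Phid.
have [gu _ tu] := fu.
have [ku _] := sym_graphon_is_graphon P (gu 0 (lexx 0)).
(* The Taylor bound involves the representative [u 0], whose velocity is almost everywhere that of
   [W]. *)
have eV := kernel_velocity_ae r hW.1 ku Wu.
apply/Linfty_normP; apply: filterS3 Phid Wu eV => z -> -> ->.
rewrite diff_quotient_le ?gt_eqF// (gtr0_norm delta0).
have := tu 0 delta (lexx 0) (ltW delta0) z; rewrite add0r => /le_trans; apply.
by rewrite -/(velocity_lip R k) expr2 mulrA [leLHS]mulrC.
Qed.
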